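(* The value function $V_\infty$ is continuously differentiable on $\mathbb{R}^n$ and, for every $x_0\in\mathbb{R}^n$, $\nabla V_\infty(x_0)=-p^\infty(0)$, where $(x^\infty,p^\infty)$ is the extremal lift associated with the optimal trajectory $x^\infty$ of $(OCP)_\infty$ starting at $x_0$.
   Context: Let $n\ge 1$ be an integer and $q\in(1,\infty)$. $J_n$ is the $n\times n$ Jordan block with eigenvalue $0$ (ones on the superdiagonal, zeros elsewhere) and $e_n$ is the last canonical basis vector of $\mathbb{R}^n$. The control system is $\dot x=J_nx+e_nu$. The function $F:\mathbb{R}^n\to\mathbb{R}_{\ge 0}$ is continuously differentiable, convex and positive definite ($F(0)=0$, $F(x)>0$ for $x\ne0$). For $x_0\in\mathbb{R}^n$ and $u\in L^q(\mathbb{R}_{\ge0},\mathbb{R})$, $\mathcal{J}_\infty(x_0,u)=\int_0^\infty\left(\frac{|u(t)|^q}{q}+F(x(t))\right)dt$, where $x(\cdot)$ is the trajectory of the control system with $x(0)=x_0$ and control $u$; the value function is $V_\infty(x_0)=\inf_{u\in L^q(\mathbb{R}_{\ge0},\mathbb{R})}\mathcal{J}_\infty(x_0,u)$, and $(OCP)_\infty$ is the corresponding minimization problem, which has a unique minimizer (optimal control) for each $x_0$; the corresponding trajectory $x^\infty$ is the optimal trajectory. For $a\in\mathbb{R}$ and $r>0$, $\lfloor a\rceil^r=|a|^r\,\mathrm{sgn}(a)$. The extremal lift of $x^\infty$ is the pair $(x^\infty,p^\infty)$, where $p^\infty:[0,\infty)\to\mathbb{R}^n$ is the unique absolutely continuous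 function such that $(x^\infty,p^\infty)$ solves $\dot x=J_nx+\lfloor p_n\rceil^{\frac1{q-1}}e_n$, $\dot p=-J_n^\top p+\nabla F(x)$ on $[0,\infty)$ (existence and uniqueness of $p^\infty$ hold for every $x_0$). *)

(* Defs.v *)
From HB Require Import structures.
From mathcomp Require Import all_boot all_order all_algebra.
From mathcomp Require Import all_classical all_reals all_analysis.

Set Implicit Arguments.
Unset Strict Implicit.
Unset Printing Implicit Defensive.

Import Order.TTheory GRing.Theory Num.Theory.
Import numFieldNormedType.Exports.

Local Open Scope classical_set_scope.
Local Open Scope ring_scope.

(* Throughout, the state space is the space of column vectors of dimension    *)
(* n.+1, so that a natural number n stands for a dimension at least 1.        *)

Definition jordan0 (R : realType) (n : nat) : 'M[R]_n.+1 :=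
  \matrix_(i, j) (j == i.+1 :> nat)%:R.

Definition elast (R : realType) (n : nat) : 'cV[R]_n.+1 := delta_mx ord_max 0.

Definition grad (R : realType) (n : nat) (f : 'cV[R]_n.+1 -> R)
    (x : 'cV[R]_n.+1) : 'cV[R]_n.+1 :=
  \col_i 'D_(delta_mx i 0) f x.

Definition continuously_differentiable (R : realType) (n : nat)
    (f : 'cV[R]_n.+1 -> R) : Prop :=
  (forall x, differentiable f x) /\ continuous (grad f).

Definition sgn_powR (R : realType) (a r : R) : R := `|a| `^ r * Num.sg a.

Definition absolutely_continuous_on (R : realType) (n : nat) (T : R)
    (x : R -> 'cV[R]_n.+1) : Prop :=
  forall e : R, 0 < e -> exists2 d : R, 0 < d &
    forall (m : nat) (a b : 'I_m -> R),
      (forall i, 0 <= a i /\ a i <= b i /\ b i <= T) ->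
      trivIset [set: 'I_m] (fun i => `]a i, b i[%classic) ->
      \sum_(i < m) (b i - a i) < d ->
      \sum_(i < m) `|x (b i) - x (a i)| < e.

(* Solutions of differential equations on [0, +oo) are taken in the sense of  *)
(* Caratheodory: absolute continuity is required on compact subintervals, and *)
(* the equation almost everywhere. Values at negative times are irrelevant.   *)
Definition has_ae_derivative (R : realType) (n : nat)
    (x v : R -> 'cV[R]_n.+1) : Prop :=
  (forall T : R, 0 < T -> absolutely_continuous_on T x) /\
  {ae (@lebesgue_measure R), forall t : R, 0 <= t -> is_derive t 1 x (v t)}.

(* L^q(R_{>=0}, R), for controls given by their values on the whole line:     *)
(* only the restriction to [0, +oo), extended by zero, matters.               *)
Definition Lq_control (R : realType) (q : R) (u : R -> R) : Prop :=
  u \_ `[0, +oo[ \in Lfun (@lebesgue_measure R) q%:E.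

Definition trajectory (R : realType) (n : nat) (x0 : 'cV[R]_n.+1)
    (u : R -> R) (x : R -> 'cV[R]_n.+1) : Prop :=
  x 0 = x0 /\
  has_ae_derivative x (fun t => jordan0 R n *m x t + u t *: elast R n).

Definition cost (R : realType) (n : nat) (q : R) (F : 'cV[R]_n.+1 -> R)
    (u : R -> R) (x : R -> 'cV[R]_n.+1) : \bar R :=
  (\int[@lebesgue_measure R]_(t in `[0%R, +oo[)
     (`|u t| `^ q / q + F (x t))%:E)%E.

(* The trajectory is determined on [0, +oo) by x0 and u, hence the infimum    *)
(* over pairs (u, x) is the infimum over the controls u.                      *)
Definition admissible (R : realType) (n : nat) (q : R) (x0 : 'cV[R]_n.+1)
    (u : R -> R) (x : R -> 'cV[R]_n.+1) : Prop :=
  Lq_control q u /\ trajectory x0 u x.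

Definition value (R : realType) (n : nat) (q : R) (F : 'cV[R]_n.+1 -> R)
    (x0 : 'cV[R]_n.+1) : \bar R :=
  ereal_inf [set c | exists u x, admissible q x0 u x /\ c = cost q F u x].

Definition optimal (R : realType) (n : nat) (q : R) (F : 'cV[R]_n.+1 -> R)
    (x0 : 'cV[R]_n.+1) (u : R -> R) (x : R -> 'cV[R]_n.+1) : Prop :=
  admissible q x0 u x /\ cost q F u x = value q F x0.

Definition extremal_lift (R : realType) (n : nat) (q : R)
    (F : 'cV[R]_n.+1 -> R) (x p : R -> 'cV[R]_n.+1) : Prop :=
  has_ae_derivative x (fun t =>
    jordan0 R n *m x t + sgn_powR (p t ord_max 0) (q - 1)^-1 *: elast R n) /\
  has_ae_derivative p (fun t => - ((jordan0 R n)^T *m p t) + grad F (x t)).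

(* Main.v *)
(* Any displacement [h] of the initial state can be steered to the origin on
   [0, 1] by a control [v_h] with trajectory [y_h], both of size O(|h|) and
   vanishing after time 1. Adding (v_h, y_h) and -(v_h, y_h) to a nearly optimal
   pair (u, x) changes the cost only on [0, 1], where the first-order terms
   cancel and the remainder is o(|h|) uniformly in the pair, because the cost
   controls u in L^q and x in the sup norm. Hence
   V(x0 + h) + V(x0 - h) - 2 V(x0) <= o(|h|); as V is convex and finite, it is
   differentiable, and a differentiable convex function is C^1. No optimal
   control is needed for this part.

   If (u, x) is optimal with costate p, then |u|^(q-1) sgn u = p_n, and the first
   variation of the cost, the integral over [0, 1] of p_n v_h + <grad F(x), y_h>,
   is the integral of the derivative of <p, y_h>, that is - <p(0), h>. So
   V(x0 + h) <= V(x0) - <p(0), h> + o(|h|), which forces grad V(x0) = - p(0). *)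

Require Import Defs.
From HB Require Import structures.
From mathcomp Require Import all_boot all_order all_algebra.
From mathcomp Require Import all_classical all_reals all_analysis.
From mathcomp Require Import measurable_realfun.
From mathcomp Require Import zify ring lra.

Set Implicit Arguments.
Unset Strict Implicit.
Unset Printing Implicit Defensive.

Import Order.TTheory GRing.Theory Num.Theory.
Import numFieldNormedType.Exports.

Local Open Scope classical_set_scope.
Local Open Scope ring_scope.

(** The obstacle is uniformity: a nearly optimal [u] is bounded in L^q only, so no pointwise modulus
    of continuity controls the derivative of [|u| ^ q / q] along it. The remainder is therefore
    estimated by a small multiple of [|h| * (1 + |u| ^ q)], and [|u| ^ q] is at most [q] times the
    Lagrangian: the error becomes a small fraction of the cost itself plus a small constant on
    [0, 1]. The trajectory, in contrast, stays in a fixed ball on [0, 1], where [grad F] is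
    uniformly continuous. Perturbations that vanish after time 1 localize the infinite horizon:
    [<p, y_h>] is zero at 1, so the behaviour of the costate at infinity does not enter. Solutions
    are meant in the sense of Caratheodory, with absolute continuity in its epsilon-delta form;
    integrating their derivatives takes the fundamental theorem of calculus in that generality,
    which is derived from the case of a derivative vanishing almost everywhere. *)

(** * Column vectors: scalar product, sup norm, directional derivatives *)

Definition dotp (R : realType) (n : nat) (c h : 'cV[R]_n.+1) : R :=
  \sum_i c i 0 * h i 0.

Lemma dotp_linear (R : realType) (n : nat) (c : 'cV[R]_n.+1) :
  linear (dotp c : 'cV[R]_n.+1 -> R).
Proof.
move=> a u v; rewrite /dotp /= scaler_sumr -big_split; apply: eq_bigr => i _.
by rewrite !mxE mulrDr [X in X + _]mulrCA.
Qed.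

HB.instance Definition _ (R : realType) (n : nat) (c : 'cV[R]_n.+1) :=
  GRing.isLinear.Build R 'cV[R]_n.+1 R _ (dotp c) (@dotp_linear R n c).

Lemma cV_coord_le (R : realType) (n : nat) (x : 'cV[R]_n.+1) i :
  `|x i 0| <= `|x|.
Proof.
rewrite [leRHS]/Num.norm /= mx_normrE.
exact: (le_bigmax _ (fun i : 'I_n.+1 * 'I_1 => `|x i.1 i.2|) (i, 0)).
Qed.

Lemma cV_norm_le (R : realType) (n : nat) (x : 'cV[R]_n.+1) B :
  (forall i, `|x i 0| <= B) -> `|x| <= B.
Proof.
move=> xB; rewrite [leLHS]/Num.norm /= mx_normrE.
apply: bigmax_le; first exact: le_trans (xB ord0).
by move=> [i j] _ /=; rewrite ord1.
Qed.

Lemma dotp_continuous (R : realType) (n : nat) (c : 'cV[R]_n.+1) :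
  continuous (dotp c).
Proof.
apply: continuous_big => [|i _]; first exact: add_continuous.
move=> x; have := (@continuousM R _ (fun=> c i 0) (fun h : 'cV[R]_n.+1 => h i 0) x).
apply; first exact: cst_continuous.
exact: coord_continuous.
Qed.

Lemma cV_sum_delta (R : realType) (n : nat) (h : 'cV[R]_n.+1) :
  h = \sum_i h i 0 *: delta_mx i 0.
Proof.
by rewrite {1}(matrix_sum_delta h); apply: eq_bigr => i _; rewrite big_ord1.
Qed.

Lemma derive_dotp (R : realType) (n : nat) (f : 'cV[R]_n.+1 -> R) x h :
  differentiable f x -> 'D_h f x = dotp (grad f x) h.
Proof.
move=> df; rewrite deriveE// {1}(cV_sum_delta h) linear_sum.
apply: eq_bigr => i _.
by rewrite linearZ /= mxE deriveE// mulrC.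
Qed.

(** Convexity with plain real weights, instead of weights bundled with their membership in [0, 1],
    so that the inequalities feed directly into real arithmetic. *)
Definition convexR (R : realType) (V : lmodType R) (f : V -> R) : Prop :=
  forall x y (s : R), 0 <= s -> s <= 1 ->
    f (s *: x + (1 - s) *: y) <= s * f x + (1 - s) * f y.

Lemma convex_functionP (R : realType) (V : lmodType R) (f : V -> R) :
  convex_function [set: convex_lmodType V] f -> convexR f.
Proof.
move=> cf x y s s0 s1.
have si : Itv.spec (@Itv.num_sem R) (Itv.Real `[0%Z, 1%Z]) s.
  by apply/andP; split; rewrite /= ?num_real// in_itv/= s0 s1.
have := cf (Itv.mk si) x y; rewrite !inE => /(_ I I).
by rewrite !convRE.
Qed.

Lemma derive_right_slope (R : realType) (n : nat) (f : 'cV[R]_n.+1 -> R) x h :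
  differentiable f x -> forall e, 0 < e -> exists2 d, 0 < d &
   forall s, 0 < s -> s < d ->
    `|(f (x + s *: h) - f x) / s - 'D_h f x| <= e.
Proof.
move=> df e e0.
have /cvgrPdist_le /(_ _ e0) : (fun s => s^-1 *: ((f \o shift x) (s *: h) - f x))
    @ 0^' --> 'D_h f x by exact: diff_derivable.
move=> /nbhs_ballP[d/= d0 H]; exists d => // s s0 sd.
have := H s; rewrite -ball_normE /= sub0r normrN gtr0_norm// => /(_ sd).
rewrite gt_eqF// => /(_ isT).
by rewrite distrC /= [_ + x]addrC [_ *: _]mulrC.
Qed.

(** * Convex functions *)

(** With [r = s t / (s + t)], the point [x + r (h + k)] is the convex combination of [x + s h] and
    [x + t k] with weights [t / (s + t)] and [s / (s + t)]. As [s] and [t] are independent, infima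
    can be taken over each separately. *)
Lemma convex_slopeD (R : realType) (V : lmodType R) (f : V -> R) x h k
    (s t : R) : convexR f -> 0 < s -> 0 < t ->
  exists2 r, 0 < r & (f (x + r *: (h + k)) - f x) / r <=
    (f (x + s *: h) - f x) / s + (f (x + t *: k) - f x) / t.
Proof.
move=> cf s0 t0; have st0 : 0 < s + t by rewrite addr_gt0.
exists (s * t / (s + t)); first by rewrite divr_gt0 ?mulr_gt0.
rewrite ler_pdivrMr; last by rewrite divr_gt0 ?mulr_gt0.
have -> : x + (s * t / (s + t)) *: (h + k) =
    (t / (s + t)) *: (x + s *: h) + (1 - t / (s + t)) *: (x + t *: k).
  have -> : 1 - t / (s + t) = s / (s + t).
    by rewrite -{1}(@divff _ (s + t)) ?gt_eqF// -mulrBl addrK.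
  rewrite !scalerDr !scalerA addrACA -scalerDl -mulrDl (addrC t s).
  rewrite divff ?gt_eqF// scale1r; congr (_ + (_ *: _ + _ *: _)); ring.
have p0 : 0 <= t / (s + t) by rewrite divr_ge0 ?ltW.
have p1 : t / (s + t) <= 1 by rewrite ler_pdivrMr// mul1r lerDr ltW.
have H := cf (x + s *: h) (x + t *: k) (t / (s + t)) p0 p1.
rewrite lerBlDr (le_trans H)// le_eqVlt; apply/orP; left; apply/eqP.
by field; rewrite !gt_eqF.
Qed.

(* The right directional derivative [D] of a convex function is sublinear;
   the second-order bound makes it odd, hence linear, and the same bound turns
   [D h <= f (x + h) - f x] into a two-sided estimate. *)
Lemma convex_differentiable (R : realType) (n : nat) (f : 'cV[R]_n.+1 -> R) x :
  convexR f ->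
  (forall e, 0 < e -> exists2 d, 0 < d & forall h, `|h| <= d ->
     f (x + h) + f (x - h) <= f x + f x + e * `|h|) ->
  differentiable f x.
Proof.
move=> cf sec.
pose q (h : 'cV[R]_n.+1) (s : R) := (f (x + s *: h) - f x) / s.
pose Q h := [set q h s | s in [set s | 0 < s]].
(* The infimum over all steps stands for the limit at 0+, so monotonicity of the slopes never has to
   be established. *)
pose D h := inf (Q h).
have q0 s : q 0 s = 0 by rewrite /q scaler0 addr0 subrr mul0r.
have Q0 h : Q h !=set0 by exists (q h 1); exists 1 => /=.
(* Opposite displacements add up to 0, whose slopes vanish: by [convex_slopeD], slopes along [- h]
   bound those along [h] from below, so the infimum is finite. *)
have qlb h s t : 0 < s -> 0 < t -> - q (- h) t <= q h s.
  move=> s0 t0; have [r r0] := convex_slopeD x h (- h) cf s0 t0.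
  by rewrite subrr -/(q 0 r) q0 -!/(q _ _) => ?; rewrite lerNl -subr_ge0 opprK addrC.
have Qlb h : has_lbound (Q h).
  by exists (- q (- h) 1) => _ [s /= s0 <-]; exact: qlb.
have Dle h s : 0 < s -> D h <= q h s by move=> s0; apply: ge_inf => //; exists s.
have Dge h a : (forall s, 0 < s -> a <= q h s) -> a <= D h.
  by move=> H; apply: lb_le_inf => // _ [s /= s0 <-]; exact: H.
have DD h k : D (h + k) <= D h + D k.
  rewrite -lerBlDr; apply: (Dge) => s s0; rewrite lerBlDr [leRHS]addrC -lerBlDr.
  apply: Dge => t t0; rewrite lerBlDr [leRHS]addrC.
  have [r r0] := convex_slopeD x h k cf s0 t0.
  exact/le_trans/Dle.
have D0 : D 0 = 0.
  apply/eqP; rewrite eq_le; apply/andP; split.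
    by rewrite -(q0 1); exact: Dle.
  by apply: (Dge) => s _; rewrite q0.
have DZp c h : 0 < c -> D (c *: h) <= c * D h.
  move=> c0; rewrite mulrC -ler_pdivrMr//; apply: Dge => s s0.
  rewrite ler_pdivrMr// (le_trans (Dle _ (s / c) _)) ?divr_gt0//.
  by rewrite /q scalerA divfK ?gt_eqF// invf_div mulrA mulrAC.
have Dopp h : D h + D (- h) <= 0.
  rewrite leNgt; apply/negP => D_gt0.
  set m := D h + D (- h) in D_gt0.
  (* At the displacement [s h] this constant makes the second difference smaller than [s m], whereas
     the two slopes force it to be at least [s m]. The [+ 1] covers [h = 0]. *)
  have e0 : 0 < m / (2 * (`|h| + 1)) by rewrite divr_gt0// mulr_gt0// ltr_wpDl.
  have [d d0 /(_ ((d / (`|h| + 1)) *: h))] := sec _ e0.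
  set s := d / (`|h| + 1).
  have s0 : 0 < s by rewrite divr_gt0// ltr_wpDl.
  have sh : s * `|h| <= d.
    by rewrite /s mulrAC ler_pdivrMr ?ltr_wpDl// ler_wpM2l ?ltW// ltrDl.
  rewrite normrZ gtr0_norm// sh => /(_ isT) H.
  have : m <= q h s + q (- h) s by apply: lerD; exact: Dle.
  rewrite /q -mulrDl ler_pdivlMr// leNgt => /negP; apply.
  rewrite scalerN; have -> u v : u - f x + (v - f x) = u + v - (f x + f x) by ring.
  rewrite ltrBlDl (le_lt_trans H)// ltrD2l.
  rewrite mulrAC ltr_pdivrMr ?mulr_gt0 ?ltr_wpDl//.
  rewrite -!mulrA ltr_pM2l// ltr_pM2l//.
  rewrite ltr_pM2l ?invr_gt0 ?ltr_wpDl//.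
  by have := normr_ge0 h; lra.
have DN h : D (- h) = - D h.
  apply/eqP; rewrite eq_le; apply/andP; split.
    by have := Dopp h; lra.
  by have := DD h (- h); rewrite subrr D0; lra.
have DDe h k : D (h + k) = D h + D k.
  apply/eqP; rewrite eq_le DD/=.
  by have := DD (- h) (- k); rewrite -opprD !DN; lra.
have DZ c h : D (c *: h) = c * D h.
  have pos b g : 0 < b -> D (b *: g) = b * D g.
    move=> b0; apply/eqP; rewrite eq_le DZp//=.
    have := DZp b^-1 (b *: g); rewrite invr_gt0 => /(_ b0).
    by rewrite scalerA mulVf ?gt_eqF// scale1r mulrC ler_pdivlMr// mulrC.
  have [c0|c0|->] := ltgtP c 0; last by rewrite scale0r D0 mul0r.
    rewrite -[c]opprK scaleNr DN pos ?oppr_gt0//; ring.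
  exact: pos.
pose c : 'cV[R]_n.+1 := \col_i D (delta_mx i 0).
have DE h : D h = dotp c h.
  rewrite {1}(cV_sum_delta h) /dotp (big_morph D DDe D0).
  by apply: eq_bigr => i _; rewrite DZ mxE mulrC.
have lo h : D h <= f (x + h) - f x.
  by have := Dle h 1; rewrite /q scale1r divr1; exact.
have dfE := @diff_unique R _ _ f (dotp c) x (@dotp_continuous R n c).
suff fD : f \o shift x = cst (f x) + dotp c +o_ (0 : 'cV[R]_n.+1) (id : 'cV[R]_n.+1 -> 'cV[R]_n.+1).
  apply/diff_locallyP; rewrite (dfE fD).
  by split => //; exact: dotp_continuous.
- apply/eqaddoP => e e0; have [d d0 H] := sec _ e0.
  apply/nbhs_ballP; exists d => //= h; rewrite -ball_normE /= sub0r normrN => hd.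
  rewrite -[X in `|X|]/(f (h + x) - (f x + dotp c h)) -DE addrC (addrC h).
  have l1 := lo h; have := lo (- h); rewrite DN => l2.
  have := H _ (ltW hd) => l3.
  rewrite ger0_norm; lra.
Qed.

(** By convexity the slope at any step [s <= 1] is at most the slope at step 1; a small [s] brings
    it within [e] of the derivative. *)
Lemma convex_tangent (R : realType) (n : nat) (f : 'cV[R]_n.+1 -> R) x h :
  convexR f -> differentiable f x -> f x + 'D_h f x <= f (x + h).
Proof.
move=> cf df; rewrite -lerBrDl; apply/ler_addgt0Pr => e e0.
have [d d0 H] := derive_right_slope h df e0.
pose s := Num.min (d / 2) 1.
have s0 : 0 < s by rewrite lt_min divr_gt0/=.
have sd : s < d by rewrite gt_min; apply/orP; left; lra.
have s1 : s <= 1 by rewrite ge_min lexx orbT.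
have := H s s0 sd; rewrite ler_distlC => /andP[_ /le_trans]; apply.
rewrite lerD2r ler_pdivrMr//.
have := cf (x + h) x s (ltW s0) s1.
have -> : s *: (x + h) + (1 - s) *: x = x + s *: h.
  by rewrite scalerDr addrAC -scalerDl subrKC scale1r.
by move=> ?; lra.
Qed.

(** Each [y |-> 'D_h f y] is upper semicontinuous: [convex_tangent] bounds it by the slope at [y]
    with a fixed step, which is continuous in [y] and close to ['D_h f x] at [x]. Lower
    semicontinuity is the same statement for [- h]. *)
Lemma convex_grad_continuous (R : realType) (n : nat) (f : 'cV[R]_n.+1 -> R) :
  convexR f -> (forall x, differentiable f x) -> continuous (grad f).
Proof.
move=> cf df x.
have up h e : 0 < e -> \forall y \near x, 'D_h f y <= 'D_h f x + e.
  move=> e0; have e20 : 0 < e / 3 by lra.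
  have [d d0 H] := derive_right_slope h (df x) e20.
  pose s := d / 2.
  have s0 : 0 < s by rewrite /s; lra.
  have sd : s < d by rewrite /s; lra.
  have := H s s0 sd; rewrite ler_distlC => /andP[+ _]; set X := _ / s => HX.
  have es0 : 0 < e / 3 * s by rewrite mulr_gt0.
  have c1 : {for x, continuous f} by exact: differentiable_continuous.
  have c2 : {for x, continuous (fun y => f (y + s *: h))}.
    apply: (@continuous_comp _ _ _ (fun y => y + s *: h) f).
      have := @continuousD R 'cV[R]_n.+1 _ id (cst (s *: h)) x; apply.
        exact: cvg_id.
      exact: cst_continuous.
    exact: differentiable_continuous.
  have /cvgrPdist_le /(_ _ es0) n1 := c1.
  have /cvgrPdist_le /(_ _ es0) n2 := c2.
  near=> y.
  have : `|f x - f y| <= e / 3 * s by near: y.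
  have : `|f (x + s *: h) - f (y + s *: h)| <= e / 3 * s by near: y.
  rewrite !ler_norml => /andP[a1 a2] /andP[b1 b2].
  have := convex_tangent (s *: h) cf (df y); rewrite !derive_dotp// linearZ /=.
  rewrite -[_ *: _]/(s * dotp (grad f y) h) => T.
  have : s * dotp (grad f y) h <= s * (X + 2 * (e / 3)).
    have XE : s * X = f (x + s *: h) - f x by rewrite /X mulrC divfK ?gt_eqF.
    rewrite mulrDr XE; lra.
  rewrite ler_pM2l// => /le_trans; apply.
  move: HX; rewrite derive_dotp//; lra.
apply/(@cvgrPdist_le R 'cV[R]_n.+1 'cV[R]_n.+1 (nbhs x) (nbhs_filter x)) => e e0.
have near_i : \forall y \near x, forall i, `|(grad f x - grad f y) i 0| <= e.
  apply: (@filter_forall _ _ _ (nbhs x) (nbhs_filter x)) => i; near=> y.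
  rewrite !mxE.
  have : 'D_(delta_mx i 0) f y <= 'D_(delta_mx i 0) f x + e.
    by near: y; exact: up.
  have : 'D_(- delta_mx i 0) f y <= 'D_(- delta_mx i 0) f x + e.
    by near: y; exact: up.
  rewrite !derive_dotp// !linearN /= -!derive_dotp// ler_norml => a b.
  by apply/andP; split; lra.
by apply: filterS near_i => y; exact: cV_norm_le.
Unshelve. all: by end_near. Qed.

(** * Absolutely continuous functions *)

(* For column vectors, [ac T x] unfolds to [absolutely_continuous_on T x];
   the two are used interchangeably. *)
Definition ac (R : realType) (V : normedModType R) (T : R) (x : R -> V) : Prop :=
  forall e : R, 0 < e -> exists2 d : R, 0 < d &
    forall (m : nat) (a b : 'I_m -> R),
      (forall i, 0 <= a i /\ a i <= b i /\ b i <= T) ->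
      trivIset [set: 'I_m] (fun i => `]a i, b i[%classic) ->
      \sum_(i < m) (b i - a i) < d ->
      \sum_(i < m) `|x (b i) - x (a i)| < e.

Lemma acS (R : realType) (V : normedModType R) (S T : R) (x : R -> V) :
  S <= T -> ac T x -> ac S x.
Proof.
move=> ST acx e /acx[d d0 H]; exists d => // m a b ab; apply: H => i.
by have [? [? bS]] := ab i; split => //; split => //; exact: le_trans ST.
Qed.

(** The common source of the closure properties: sums, multiples, coordinates and products only have
    to dominate increments. *)
Lemma ac_dominated (R : realType) (U V W : normedModType R) (T K : R)
    (x : R -> U) (y : R -> V) (z : R -> W) : 0 < K -> ac T x -> ac T y ->
  (forall a b, 0 <= a -> a <= b -> b <= T ->
     `|z b - z a| <= K * (`|x b - x a| + `|y b - y a|)) ->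
  ac T z.
Proof.
move=> K0 acx acy zxy e e0.
have e1 : 0 < e / (2 * K) by rewrite divr_gt0// mulr_gt0.
have [d d0 Hx] := acx _ e1; have [d' d'0 Hy] := acy _ e1.
exists (Num.min d d') => [|m a b ab tab]; first by rewrite lt_min d0.
rewrite lt_min => /andP[/(Hx _ _ _ ab tab) Sx /(Hy _ _ _ ab tab) Sy].
apply: (@le_lt_trans _ _
    (\sum_(i < m) K * (`|x (b i) - x (a i)| + `|y (b i) - y (a i)|))).
  by apply: ler_sum => i _; have [? [? ?]] := ab i; exact: zxy.
rewrite -mulr_sumr big_split /= -ltr_pdivlMl// mulrC.
apply: (lt_le_trans (ltrD Sx Sy)).
rewrite le_eqVlt; apply/orP; left; apply/eqP; field.
by rewrite gt_eqF.
Qed.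

Lemma lipschitz_ac (R : realType) (V : normedModType R) (T K : R) (x : R -> V) :
  0 < K -> (forall a b, 0 <= a -> a <= b -> b <= T ->
     `|x b - x a| <= K * (b - a)) -> ac T x.
Proof.
move=> K0 xK e e0; exists (e / K) => [|m a b ab _ S]; first by rewrite divr_gt0.
apply: (@le_lt_trans _ _ (\sum_(i < m) K * (b i - a i))).
  by apply: ler_sum => i _; have [? [? ?]] := ab i; exact: xK.
by rewrite -mulr_sumr mulrC -ltr_pdivlMr.
Qed.

Lemma acD (R : realType) (V : normedModType R) (T : R) (x y : R -> V) :
  ac T x -> ac T y -> ac T (fun t => x t + y t).
Proof.
move=> acx acy; apply: (ac_dominated ltr01 acx acy) => a b _ _ _.
by rewrite mul1r opprD addrACA ler_normD.
Qed.

Lemma acZ (R : realType) (V : normedModType R) (T c : R) (x : R -> V) :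
  ac T x -> ac T (fun t => c *: x t).
Proof.
move=> acx; have K0 : 0 < `|c| + 1 by rewrite ltr_wpDl.
apply: (ac_dominated K0 acx acx) => a b _ _ _.
rewrite -scalerBr normrZ ler_pM ?lerDl ?lerDr//.
Qed.

Lemma ac_coord (R : realType) (n : nat) (T : R) (x : R -> 'cV[R]_n.+1) i :
  ac T x -> ac T (fun t => x t i 0).
Proof.
move=> acx; apply: (ac_dominated ltr01 acx acx) => a b _ _ _.
rewrite mul1r ler_wpDr//; have := cV_coord_le (x b - x a) i.
by rewrite !mxE.
Qed.

Lemma ac_dist (R : realType) (V : normedModType R) (T : R) (x : R -> V) :
  ac T x -> forall e, 0 < e -> exists2 d, 0 < d & forall s t,
    0 <= s -> 0 <= t -> s <= T -> t <= T -> `|s - t| < d -> `|x s - x t| < e.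
Proof.
move=> acx e /acx[d d0 H]; exists d => //.
have aux s t : 0 <= s -> s <= t -> t <= T -> t - s < d -> `|x t - x s| < e.
  move=> s0 st tT std.
  have := H 1%N (fun=> s) (fun=> t) (fun=> conj s0 (conj st tT)).
  rewrite !big_ord1 => /(_ _ std); apply.
  by move=> i j _ _ _; rewrite [i]ord1 [j]ord1.
move=> s t s0 t0 sT tT; have [st|/ltW ts] := leP s t.
  by rewrite distrC ger0_norm ?subr_ge0// => ?; rewrite distrC; exact: aux.
by rewrite ger0_norm ?subr_ge0// => ?; exact: aux.
Qed.

Lemma ac_continuous (R : realType) (V : normedModType R) (T : R) (x : R -> V) :
  ac T x -> {within `[0, T], continuous x}.
Proof.
move=> acx; apply/subspace_continuousP => t /=; rewrite in_itv/= => /andP[t0 tT].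
apply/cvgrPdist_lt => e e0; have [d d0 H] := ac_dist acx e0.
rewrite near_withinE; apply/nbhs_ballP; exists d => //= s.
rewrite -ball_normE /= in_itv/= => std /andP[s0 sT].
exact: H.
Qed.

Lemma ac_bounded (R : realType) (T : R) (f : R -> R) : 0 <= T ->
  ac T f -> exists2 B, 0 < B & forall t, 0 <= t -> t <= T -> `|f t| <= B.
Proof.
move=> T0 acf.
have [c _ H] := EVT_max T0 (ac_continuous acf).
have [c' _ H'] := EVT_min T0 (ac_continuous acf).
exists (`|f c| + `|f c'| + 1) => [|t t0 tT].
  by rewrite ltr_wpDl// addr_ge0.
have tin : t \in `[0, T] by rewrite in_itv/= t0 tT.
have := H t tin; have := H' t tin.
have := ler_norm (f c); have := lerNnormlW (lexx `|f c'|).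
have := normr_ge0 (f c); have := normr_ge0 (f c').
by rewrite ler_norml => ? ? ? ? ? ?; apply/andP; split; lra.
Qed.

Lemma acM (R : realType) (T : R) (f g : R -> R) : 0 <= T ->
  ac T f -> ac T g -> ac T (fun t => f t * g t).
Proof.
move=> T0 acf acg.
have [B B0 fB] := ac_bounded T0 acf; have [C C0 gC] := ac_bounded T0 acg.
have K0 : 0 < B + C by rewrite addr_gt0.
apply: (ac_dominated K0 acf acg) => a b a0 ab bT.
have -> : f b * g b - f a * g a = f b * (g b - g a) + (f b - f a) * g a by ring.
rewrite (le_trans (ler_normD _ _))// !normrM mulrDr addrC lerD//.
  by rewrite mulrC ler_wpM2r// (le_trans (gC a _ _)) ?(le_trans ab)// lerDr ltW.
rewrite ler_wpM2r// (le_trans (fB b _ _)) ?(le_trans a0)//.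
by rewrite lerDl ltW.
Qed.

(** * From a derivative vanishing almost everywhere to the fundamental theorem of calculus *)

(** The supremum of the times where [P] holds need not be attained, so the step jumps across [s],
    from a nearby [t0] before it to a nearby [t1] after it; this merges the closedness and openness
    conditions of the usual argument. *)
Lemma real_induction (R : realType) (T : R) (P : R -> Prop) : 0 <= T -> P 0 ->
  (forall s, 0 <= s -> s <= T -> exists2 r, 0 < r & forall t0 t1,
     0 <= t0 -> t0 <= s -> s <= t1 -> t1 <= T -> s - r < t0 -> t1 < s + r ->
     P t0 -> P t1) ->
  P T.
Proof.
move=> T0 P0 step; pose A := [set t | [/\ 0 <= t, t <= T & P t]].
have A0 : A 0 by [].
have ubA : ubound A T by move=> t [].
have supA : has_sup A by split; [exists 0|exists T].
have c0 : 0 <= sup A by exact: ub_le_sup supA.2 _ A0.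
have cT : sup A <= T by apply: ge_sup => //; exists 0.
have [r r0 H] := step _ c0 cT.
have [t0 [t00 t0T Pt0] ct0] := sup_adherent r0 supA.
have t0c : t0 <= sup A by apply: ub_le_sup => //; exact: supA.2.
pose t1 := Num.min T (sup A + r / 2).
have ct1 : sup A <= t1 by rewrite le_min cT lerDl divr_ge0 ?ltW.
have t1T : t1 <= T by rewrite ge_min lexx.
have t1r : t1 < sup A + r by rewrite gt_min ltrD2l; apply/orP; right; lra.
have Pt1 : P t1 by exact: (H t0 t1).
have : t1 <= sup A by apply: ub_le_sup; [exact: supA.2|split => //; exact: le_trans ct1].
move: Pt1; rewrite /t1; have [//|_ _] := leP T; lra.
Qed.

Lemma lebesgue_measure_oo (R : realType) (a b : R) : a <= b ->
  @lebesgue_measure R `]a, b[%classic = (b - a)%:E.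
Proof.
rewrite lebesgue_measure_itv /= lte_fin le_eqVlt => /predU1P[->|->//].
by rewrite ltxx subrr.
Qed.

Lemma disjoint_length_le (R : realType) (m : nat) (a b : 'I_m -> R) (U : set R) :
  (forall i, a i <= b i) -> measurable U -> (forall i, `]a i, b i[ `<=` U) ->
  trivIset [set: 'I_m] (fun i => `]a i, b i[%classic) ->
  ((\sum_(i < m) (b i - a i))%:E <= @lebesgue_measure R U)%E.
Proof.
move=> ab mU abU tab; rewrite -sumEFin.
rewrite (eq_bigr (fun i => @lebesgue_measure R `]a i, b i[%classic)).
  rewrite -measure_bigsetU_ord//; apply: le_measure; rewrite ?inE//.
    by apply: bigsetU_measurable => i _.
  by apply: (big_ind (fun A => A `<=` U)) => // A B AU BU t [/AU|/BU].
by move=> i _; rewrite lebesgue_measure_oo.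
Qed.

(* Real induction along [0, T]: where the derivative vanishes, the increment is
   at most [e'] times the length; the exceptional points are covered by an open
   set of small measure, over which absolute continuity bounds the increments. *)
Lemma ac_derive0_cst (R : realType) (T : R) (f : R -> R) : 0 < T -> ac T f ->
  {ae (@lebesgue_measure R), forall t, 0 < t -> t < T -> is_derive t 1 f 0} ->
  f T = f 0.
Proof.
move=> T0 acf [N [mN N0 fN]].
apply/eqP; rewrite -subr_eq0 -normr_le0; apply/ler_addgt0Pr => e e0.
(* Regular points contribute at most [e' * T] and the exceptional intervals [e'], in total [e]. *)
rewrite add0r; pose e' := e / (T + 1).
have T10 : 0 < T + 1 by rewrite ltr_wpDl// ltW.
have e'0 : 0 < e' by rewrite divr_gt0.
have [d d0 Hd] := acf _ e'0.
(* The endpoints, where nothing is assumed on the derivative, are treated as exceptional. *)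
pose N' := N `|` [set 0] `|` [set T].
have mN' : measurable N' by do 2 apply: measurableU => //.
have N'0 : @lebesgue_measure R N' = 0%E.
  apply/negligibleP => //; apply: negligibleU; first apply: negligibleU.
  - exact/negligibleP.
  - by apply/negligibleP => //; exact: lebesgue_measure_set1.
  - by apply/negligibleP => //; exact: lebesgue_measure_set1.
have N'y : (@lebesgue_measure R N' < +oo)%E by rewrite N'0 ltry.
have [U [oU NU Ud]] := lebesgue_regularity_outer mN' N'y d0.
have mU : measurable U by exact: open_measurable.
have {}Ud : (@lebesgue_measure R U < d%:E)%E.
  have -> : @lebesgue_measure R U =
      (@lebesgue_measure R N' + @lebesgue_measure R (U `\` N'))%E.
    rewrite -{1}(setDUK NU) measureU//; first exact: measurableD.
    by rewrite setDIK.
  by rewrite N'0 add0e.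
(* The invariant records the intervals crossed inside [U] instead of a bound on their increments:
   absolute continuity bounds the whole family at once, at the end, and not each interval as it is
   added. *)
pose P t := exists (m : nat) (a b : 'I_m -> R),
  [/\ forall i, 0 <= a i /\ a i <= b i /\ b i <= t,
      trivIset [set: 'I_m] (fun i => `]a i, b i[%classic),
      forall i, `]a i, b i[ `<=` U &
      `|f t - f 0| <= e' * t + \sum_(i < m) `|f (b i) - f (a i)|].
suff [m [a [b [ab tab abU Pf]]]] : P T.
  rewrite (le_trans Pf)// (@le_trans _ _ (e' * T + e'))//.
    rewrite lerD2l ltW// Hd// -lte_fin (le_lt_trans _ Ud)//.
    by apply: disjoint_length_le => // i; have [? []] := ab i.
  by rewrite -[X in _ + X]mulr1 -mulrDr divfK// gt_eqF.
apply: real_induction; first exact: ltW.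
  exists 0%N, (fun=> 0), (fun=> 0); split; [by case|by case|by case|].
  by rewrite subrr normr0 big_ord0 mulr0 addr0.
move=> s s0 sT; have [sN|sN] := pselect (U s).
  have /nbhs_ballP[r /= r0 rU] : nbhs s U by exact: open_nbhs_nbhs.
  exists r => // t0 t1 t00 t0s st1 t1T srt0 t1sr [m [a [b [ab tab abU Pf]]]].
  pose ext (v : R) (g : 'I_m -> R) (i : 'I_m.+1) :=
    if unlift ord0 i is Some j then g j else v.
  have t01U : `]t0, t1[ `<=` U.
    move=> t; rewrite /= in_itv/= => /andP[tt0 tt1]; apply: rU.
    rewrite -ball_normE /= ltr_norml; apply/andP; split; lra.
  exists m.+1, (ext t0 a), (ext t1 b); split.
  - move=> i; rewrite /ext; case: unliftP => [j _|_].
      have [? [? bt]] := ab j; split => //; split => //.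
      by rewrite (le_trans bt)// (le_trans t0s).
    by split => //; split => //; exact: le_trans st1.
  - have dis j t : `]t0, t1[%classic t -> `]a j, b j[%classic t -> False.
      rewrite /= !in_itv/= => /andP[h _] /andP[_ h'].
      by have [_ [_ h'']] := ab j; lra.
    move=> i j _ _; rewrite /ext.
    case: unliftP => [i' ->|->]; case: unliftP => [j' ->|->] // [t [h1 h2]].
    + by congr (lift _ _); apply: tab => //; exists t.
    + by case: (dis i' t).
    + by case: (dis j' t).
  - by move=> i; rewrite /ext; case: unliftP => [j _|_].
  - rewrite big_ord_recl /ext unlift_none.
    under eq_bigr do rewrite liftK.
    rewrite (le_trans (ler_distD (f t0) _ _))// addrCA lerD2l.
    rewrite (le_trans Pf)// lerD2r ler_wpM2l//; first exact: ltW.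
    exact: le_trans st1.
have [s_gt0 s_ltT] : 0 < s /\ s < T.
  rewrite !lt_neqAle s0 sT !andbT; split; apply/eqP => sE; apply: sN; apply: NU.
    by left; right.
  by right.
have fs : is_derive s 1 f 0.
  apply: contrapT => Hf; apply: sN; apply: NU; left; left; apply: fN => /=.
  by move=> H; apply: Hf; exact: H.
have : (fun h => h^-1 *: ((f \o shift s) (h *: 1) - f s)) @ 0^' --> 'D_1 f s.
  exact: (@ex_derive _ _ _ _ _ _ _ fs).
rewrite (@derive_val _ _ _ _ _ _ _ fs).
move=> /cvgrPdist_le /(_ _ e'0) /nbhs_ballP[r /= r0 Hr].
have fr t : `|t - s| < r -> `|f t - f s| <= e' * `|t - s|.
  move=> tr; have [->|ts] := eqVneq t s; first by rewrite !subrr normr0 mulr0.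
  have := Hr (t - s); rewrite -ball_normE /= sub0r normrN => /(_ tr).
  rewrite subr_eq0 ts => /(_ isT).
  rewrite sub0r normrN normrZ normfV [_ *: 1]mulr1 subrK ler_pdivrMl//.
    by rewrite mulrC.
  by rewrite normr_gt0 subr_eq0.
exists r => // t0 t1 t00 t0s st1 t1T srt0 t1sr [m [a [b [ab tab abU Pf]]]].
exists m, a, b; split => //.
  move=> i; have [? [? bt]] := ab i; split => //; split => //.
  by rewrite (le_trans bt)// (le_trans t0s).
have h1 : `|f t1 - f s| <= e' * (t1 - s).
  rewrite -[X in _ * X]ger0_norm ?subr_ge0//; apply: fr.
  by rewrite ger0_norm ?subr_ge0// ltrBlDl.
have h0 : `|f s - f t0| <= e' * (s - t0).
  rewrite distrC -[X in _ * X]ger0_norm ?subr_ge0// [X in _ * X]distrC; apply: fr.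
  by rewrite distrC ger0_norm ?subr_ge0//; lra.
rewrite (le_trans (ler_distD (f s) _ _))//.
have := ler_distD (f t0) (f s) (f 0); lra.
Qed.

Lemma ac_Rintegral (R : realType) (T : R) (g : R -> R) :
  (@lebesgue_measure R).-integrable setT (EFin \o g) ->
  ac T (fun t => \int[@lebesgue_measure R]_(s in `]-oo, t]) g s).
Proof.
move=> ig e e0; have [d [d0 Hd]] := integral_normr_continuous ig e0.
have igS A : measurable A -> (@lebesgue_measure R).-integrable A (EFin \o g).
  by move=> mA; exact: integrableS ig.
exists d => // m a b ab tab Sd; pose D := \big[setU/set0]_(i < m) `]a i, b i[%classic.
have mD : measurable D by apply: bigsetU_measurable => i _.
have /Hd : (@lebesgue_measure R D < d%:E)%E.
  have -> : @lebesgue_measure R D = (\sum_(i < m) (b i - a i))%:E.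
    rewrite -sumEFin measure_bigsetU_ord//; apply: eq_bigr => i _.
    by apply: lebesgue_measure_oo; have [_ [? _]] := ab i.
  by rewrite lte_fin.
move=> /(_ mD); apply: le_lt_trans.
have ign A : measurable A ->
    (@lebesgue_measure R).-integrable A (fun x => `|g x|%:E).
  move=> mA; have /integrable_abse := igS _ mA.
  by apply: eq_integrable => // x _ /=.
rewrite -lee_fin -sumEFin /Rintegral fineK; last exact: integrable_fin_num (ign _ mD).
rewrite ge0_integral_bigsetU//=; last 3 first.
- exact: index_enum_uniq.
- by move=> i j _ _; exact: tab.
- by apply: measurable_int (ign _ mD).
apply: lee_sum => i _.
have [_ [aib _]] := ab i.
rewrite Rintegral_itvB//; [|exact: igS].
rewrite integral_itv_bndo_bndc; last exact: measurable_int (ign _ _).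
rewrite (@le_trans _ _ (\int[@lebesgue_measure R]_(x in `]a i, b i]) `|g x|)%R%:E)//.
  by rewrite lee_fin; apply: le_normr_Rintegral => //; exact: igS.
by rewrite /Rintegral fineK//; exact: integrable_fin_num (ign _ _).
Qed.

Lemma ae_imp (R : realType) (P Q : R -> Prop) : (forall t, P t -> Q t) ->
  {ae (@lebesgue_measure R), forall t, P t} ->
  {ae (@lebesgue_measure R), forall t, Q t}.
Proof.
by move=> PQ; apply: filterS; first exact: (ae_filter_ringOfSetsType (@lebesgue_measure R)).
Qed.

Lemma ae_imp2 (R : realType) (P Q S : R -> Prop) :
  (forall t, P t -> Q t -> S t) ->
  {ae (@lebesgue_measure R), forall t, P t} ->
  {ae (@lebesgue_measure R), forall t, Q t} ->
  {ae (@lebesgue_measure R), forall t, S t}.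
Proof.
by move=> PQS; apply: filterS2; first exact: (ae_filter_ringOfSetsType (@lebesgue_measure R)).
Qed.

Lemma ae_neq (R : realType) (c : R) :
  {ae (@lebesgue_measure R), forall t, t != c}.
Proof.
exists [set c]; split => //; first exact: lebesgue_measure_set1.
by move=> t /= /negP; rewrite negbK => /eqP.
Qed.

(** By Lebesgue differentiation, [f] minus the primitive of [g] (extended by 0) has derivative 0
    almost everywhere. It is absolutely continuous, hence has equal values at 0 and [T]. *)
Lemma ac_ftc (R : realType) (T : R) (f g : R -> R) : 0 < T -> ac T f ->
  (@lebesgue_measure R).-integrable `[0, T] (EFin \o g) ->
  {ae (@lebesgue_measure R), forall t, 0 < t -> t < T -> is_derive t 1 f (g t)} ->
  f T - f 0 = \int[@lebesgue_measure R]_(s in `[0, T]) g s.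
Proof.
move=> T0 acf ig fg; pose h := g \_ `[0, T].
have ih : (@lebesgue_measure R).-integrable setT (EFin \o h).
  by rewrite -restrict_EFin; apply/integrable_restrict => //=; rewrite setTI.
pose H t := \int[@lebesgue_measure R]_(s in `]-oo, t]) h s.
have acH : ac T H by exact: ac_Rintegral.
have HE : {ae (@lebesgue_measure R), forall t, derivable H t 1 /\ H^`()%classic t = h t}.
  apply: FTC1Ny; last exact: open_integrable_locally openT ih.
  by move=> y; exact: integrableS ih.
have : (f \- H) T = (f \- H) 0.
  apply: ac_derive0_cst => //.
    have := acD acf (acZ (-1) acH).
    by under eq_fun do rewrite scaleN1r.
  apply: ae_imp2 HE fg => t [dH HE'] df t0 tT; have {}df := df t0 tT.
  have dH' : is_derive t 1 H (g t).
    apply: DeriveDef => //; rewrite -derive1E HE' /h patchE mem_set//=.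
    by rewrite in_itv/= !ltW.
  by have := is_deriveB df dH'; rewrite subrr.
rewrite /= => /eqP; rewrite subr_eq addrAC -subr_eq opprK => /eqP E.
have -> : f T - f 0 = H T - H 0 by lra.
rewrite /H Rintegral_itvB//; last by rewrite bnd_simp ltW.
  rewrite Rintegral_itv_obnd_cbnd; last exact: integrableS ih.
  by apply: eq_Rintegral => t tT; rewrite /h patchE tT.
exact: integrableS ih.
Qed.

(** * First-order estimates for the Lagrangian *)

(** Since [x + z] may leave [K], this is more than uniform continuity of the restriction to [K].
    Halving each radius of continuity leaves room for both the covering and the displacement. *)
Lemma compact_uniform (R : realType) (V W : normedModType R) (K : set V)
    (f : V -> W) : compact K -> continuous f ->
  forall e, 0 < e -> exists2 d, 0 < d &
    forall x z, K x -> `|z| <= d -> `|f (x + z) - f x| <= e.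
Proof.
move=> /compact_near_coveringP cK cf e e0.
have : \forall d \near (0:R)^'+, K `<=`
    (fun x => forall z, `|z| <= d -> `|f (x + z) - f x| <= e).
  apply: (cK R) => x Kx.
  have e20 : 0 < e / 2 by rewrite divr_gt0.
  have /cvgrPdist_le /(_ _ e20) /nbhs_ballP[r /= r0 Hr] := cf x.
  have r20 : 0 < r / 2 by rewrite divr_gt0.
  exists (ball x (r / 2), [set d | d < r / 2]).
    split => /=; first exact: nbhsx_ballx.
    exact: nbhs_right_lt.
  move=> [y d] [/= xy dr] z zd.
  have {}Hr v : `|x - v| < r -> `|f x - f v| <= e / 2.
    by move=> xv; apply: Hr; rewrite -ball_normE.
  move: xy; rewrite -ball_normE /= => xy.
  have h1 : `|f x - f y| <= e / 2 by apply: Hr; lra.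
  have h2 : `|f x - f (y + z)| <= e / 2.
    apply: Hr; rewrite opprD addrA (le_lt_trans (ler_normB _ _))//; lra.
  rewrite (le_trans (ler_distD (f x) _ _))// [X in X + _]distrC; lra.
move=> near_d.
have near_gt0 : \forall d \near (0:R)^'+, 0 < d by exact: nbhs_right_gt.
have [d [dP d0]] := filter_ex (filterI near_d near_gt0).
by exists d => // x z Kx; exact: dP.
Qed.

Lemma trmx_continuous (R : realType) (n : nat) :
  continuous (fun x : 'rV[R]_n.+1 => x^T).
Proof.
move=> x; apply/(@cvgrPdist_le R 'cV[R]_n.+1 'rV[R]_n.+1 (nbhs x) (nbhs_filter x)).
move=> e e0; apply/nbhs_ballP; exists e => //= y; rewrite -ball_normE /= => xy.
apply: cV_norm_le => i; rewrite !mxE.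
rewrite (le_trans _ (ltW xy))// [leRHS]/Num.norm /= mx_normrE.
have := le_bigmax 0 (fun k : 'I_1 * 'I_n.+1 => `|(x - y) k.1 k.2|) (0, i).
by rewrite /= !mxE.
Qed.

(** For the sup norm the ball is a box, compact as a set of row vectors and carried over by
    transposition. *)
Lemma cV_ball_compact (R : realType) (n : nat) (B : R) :
  compact [set x : 'cV[R]_n.+1 | `|x| <= B].
Proof.
have -> : [set x : 'cV[R]_n.+1 | `|x| <= B] =
    (fun x : 'rV[R]_n.+1 => x^T) @` [set x : 'rV[R]_n.+1 | forall i, x 0 i \in `[(- B), B]].
  apply/seteqP; split => [x /= xB|_ [x /= xB <-]].
    exists x^T; last by rewrite trmxK.
    move=> i; rewrite in_itv/= -ler_norml mxE.
    exact: le_trans (cV_coord_le _ _) xB.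
  by apply: cV_norm_le => i; rewrite mxE ler_norml; have := xB i; rewrite in_itv.
apply: continuous_compact.
  exact/continuous_subspaceT/trmx_continuous.
apply: (@rV_compact _ _ (fun=> `[(- B), B]%classic)) => _.
exact: segment_compact.
Qed.

Lemma normr_sgn_powR (R : realType) (a r : R) : 0 < r ->
  `|sgn_powR a r| = `|a| `^ r.
Proof.
move=> r0; rewrite /sgn_powR normrM (ger0_norm (powR_ge0 _ _)).
have [->|a0] := eqVneq a 0; first by rewrite normr0 powR0 ?mul0r ?gt_eqF.
by rewrite normr_sg a0 mulr1.
Qed.

Lemma sgn_powRM (R : realType) (a b r : R) :
  sgn_powR (a * b) r = sgn_powR a r * sgn_powR b r.
Proof. by rewrite /sgn_powR normrM powRM// sgrM mulrACA. Qed.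

Lemma sgn_powRK (R : realType) (a r : R) : 0 < r ->
  sgn_powR (sgn_powR a r^-1) r = a.
Proof.
move=> r0; rewrite {1}/sgn_powR normr_sgn_powR ?invr_gt0// -powRrM.
rewrite mulVf ?gt_eqF// powRr1// /sgn_powR sgrM sgr_id.
have [->|a0] := eqVneq a 0; first by rewrite normr0 mul0r.
rewrite gtr0_sg ?mul1r; last by rewrite powR_gt0 // normr_gt0.
by rewrite mulrC -numEsg.
Qed.

(** Away from 0 the sign is locally constant; at 0 the radius [e ^ (1 / r)] is explicit. *)
Lemma sgn_powR_continuous (R : realType) (r : R) : 0 < r ->
  continuous (fun a => sgn_powR a r).
Proof.
move=> r0 a; have [->|a0] := eqVneq a 0.
  apply/cvgrPdist_le => e e0.
  have d0 : 0 < e `^ r^-1 by rewrite powR_gt0.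
  apply/nbhs_ballP; exists (e `^ r^-1) => //= b; rewrite /ball_/= sub0r normrN.
  move=> bd; rewrite /sgn_powR sgr0 mulr0 sub0r normrN -/(sgn_powR b r).
  rewrite normr_sgn_powR// (@le_trans _ _ ((e `^ r^-1) `^ r))//.
    by apply: ge0_ler_powR; rewrite ?nnegrE ?normr_ge0 ?powR_ge0// ltW.
  by rewrite -powRrM mulVf ?gt_eqF// powRr1// ltW.
have na0 : 0 < `|a| by rewrite normr_gt0.
have cnorm : {for a, continuous (fun b => `|b| `^ r)}.
  have := @continuous_comp R R R Num.norm (fun c => c `^ r) a; apply.
    exact: norm_continuous.
  apply/differentiable_continuous/derivable1_diffP/derivable_powR.
  by rewrite in_itv/= andbT.
have cpow : {for a, continuous (fun b => `|b| `^ r * Num.sg a)}.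
  have := @continuousM R _ (fun b => `|b| `^ r) (cst (Num.sg a)) a cnorm.
  by apply; exact: cst_continuous.
rewrite /continuous_at in cpow *.
apply: cvg_trans cpow; apply: near_eq_cvg.
have [a_gt0|a_lt0|aE] := ltgtP a 0; last by rewrite aE eqxx in a0.
  near=> b; have b0 : b < 0 by near: b; exact: lt_nbhsl.
  by rewrite /sgn_powR !ltr0_sg.
near=> b; have b0 : 0 < b by near: b; exact: lt_nbhsr.
by rewrite /sgn_powR !gtr0_sg.
Unshelve. all: by end_near. Qed.

(* Young's inequality for [b] and [|a| ^ (q - 1)], with conjugate exponents [q]
   and [q / (q - 1)]. *)
Lemma powR_tangent (R : realType) (q a b : R) : 1 < q ->
  `|a| `^ q / q + sgn_powR a (q - 1) * (b - a) <= `|b| `^ q / q.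
Proof.
move=> q1; have q0 : 0 < q by lra.
have q10 : 0 < q - 1 by lra.
have pq : q^-1 + (q / (q - 1))^-1 = 1.
  by rewrite invf_div; field; rewrite gt_eqF.
have young := conjugate_powR (normr_ge0 b) (powR_ge0 `|a| (q - 1)) q0
  (divr_gt0 q0 q10) pq.
have aE : sgn_powR a (q - 1) * a = `|a| `^ q.
  by rewrite /sgn_powR -mulrA -normrEsg mulrC mulr_powRB1.
have powE : (`|a| `^ (q - 1)) `^ (q / (q - 1)) = `|a| `^ q.
  by rewrite -powRrM mulrC divfK ?gt_eqF.
rewrite powE invf_div in young.
have sb : sgn_powR a (q - 1) * b <= `|b| * `|a| `^ (q - 1).
  by rewrite (le_trans (ler_norm _))// normrM normr_sgn_powR// mulrC.
rewrite mulrBr aE.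
have -> : `|a| `^ q / q = `|a| `^ q - `|a| `^ q * ((q - 1) / q).
  by field; rewrite gt_eqF.
lra.
Qed.

(* Uniform continuity on [-1, 1] handles small [a]; for [|a| > 1] homogeneity
   reduces the increment at [a] to one at [1]. *)
Lemma sgn_powR_uniform (R : realType) (q : R) : 1 < q ->
  forall e, 0 < e -> exists2 d, 0 < d & forall a b, `|b| <= d ->
    `|sgn_powR (a + b) (q - 1) - sgn_powR a (q - 1)| <= e * (1 + `|a| `^ q).
Proof.
move=> q1 e e0; have q10 : 0 < q - 1 by lra.
have cK : compact (`[(-1), 1]%classic : set R) by exact: segment_compact.
have [d d0 Hd] := compact_uniform cK (sgn_powR_continuous q10) e0.
exists d => // a b bd; have [a1|a1] := leP `|a| 1.
  rewrite (le_trans (Hd a b _ bd)) ?ler_pMr ?lerDl ?powR_ge0//.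
  by rewrite /= in_itv/= -ler_norml.
have a0 : a != 0 by rewrite -normr_gt0; lra.
have -> : a + b = a * (1 + b / a) by field.
have aE : sgn_powR a (q - 1) = sgn_powR a (q - 1) * sgn_powR 1 (q - 1).
  by rewrite -sgn_powRM mulr1.
rewrite sgn_powRM [X in _ - X]aE.
rewrite -mulrBr normrM normr_sgn_powR// mulrC.
apply: (@le_trans _ _ (e * `|a| `^ (q - 1))).
  rewrite ler_wpM2r ?powR_ge0//; apply: Hd.
    by rewrite /= in_itv/= lexx andbT; lra.
  by rewrite normrM normfV ler_pdivrMr ?normr_gt0// (le_trans bd)// ler_pMr// ltW.
rewrite ler_pM2l// ler_wpDl//; apply: ler_powR; [exact: ltW|lra].
Qed.

Lemma dotp_le (R : realType) (n : nat) (c h : 'cV[R]_n.+1) :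
  `|dotp c h| <= n.+1%:R * `|c| * `|h|.
Proof.
rewrite (le_trans (ler_norm_sum _ _ _))//.
rewrite (@le_trans _ _ (\sum_(i < n.+1) (`|c| * `|h|)))//.
  by apply: ler_sum => i _; rewrite normrM ler_pM// cV_coord_le.
by rewrite sumr_const card_ord -mulrA mulr_natl.
Qed.

Lemma dotpBl (R : realType) (n : nat) (c c' h : 'cV[R]_n.+1) :
  dotp (c - c') h = dotp c h - dotp c' h.
Proof.
by rewrite /dotp -sumrB; apply: eq_bigr => i _; rewrite !mxE mulrBl.
Qed.

(** Convertible to the integrand of [cost], so estimates on it apply under the integral. *)
Definition lagrangian (R : realType) (n : nat) (q : R)
    (F : 'cV[R]_n.+1 -> R) (u : R) (x : 'cV[R]_n.+1) : R :=
  `|u| `^ q / q + F x.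

(** The tangent inequality taken at the displaced point bounds the increment from above by the
    derivative there; uniform continuity brings that derivative back to the base point. The weight
    [1 + |a| ^ q] appears because [a], unlike [x], is not confined to a compact set. *)
Lemma lagrangian_upper (R : realType) (n : nat) (q : R)
    (F : 'cV[R]_n.+1 -> R) : 1 < q ->
  continuously_differentiable F -> convexR F ->
  forall B e, 0 < e -> exists2 d, 0 < d & forall a x w z,
    `|x| <= B -> `|w| <= d -> `|z| <= d ->
    lagrangian q F (a + w) (x + z) <=
      lagrangian q F a x + (sgn_powR a (q - 1) * w + dotp (grad F x) z) +
      e * (`|w| + `|z|) * (1 + `|a| `^ q).
Proof.
move=> q1 [dF cF] cvF B e e0.
have [d d0 Hd] := sgn_powR_uniform q1 e0.
(* Compensates the factor [n.+1] of [dotp_le], which is due to the sup norm. *)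
have e'0 : 0 < e / n.+1%:R by rewrite divr_gt0.
have [d' d'0 Hd'] := compact_uniform (@cV_ball_compact R n B) cF e'0.
exists (Num.min d d'); first by rewrite lt_min d0.
move=> a x w z xB; rewrite !le_min => /andP[wd _] /andP[_ zd'].
have hpow : `|a + w| `^ q / q <= `|a| `^ q / q + sgn_powR a (q - 1) * w +
    e * `|w| * (1 + `|a| `^ q).
  have := powR_tangent (a + w) a q1.
  have : (sgn_powR (a + w) (q - 1) - sgn_powR a (q - 1)) * w <=
      e * (1 + `|a| `^ q) * `|w|.
    rewrite (le_trans (ler_norm _))// normrM ler_wpM2r//; exact: Hd.
  lra.
have hF : F (x + z) <= F x + dotp (grad F x) z + e * `|z|.
  have := convex_tangent (- z) cvF (dF (x + z)).
  rewrite derive_dotp// linearN addrK /=.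
  have : dotp (grad F (x + z) - grad F x) z <= e * `|z|.
    rewrite (le_trans (ler_norm _))// (le_trans (dotp_le _ _))// ler_wpM2r//.
    by rewrite mulrC -ler_pdivlMr//; exact: Hd'.
  rewrite dotpBl; lra.
have : e * `|z| <= e * `|z| * (1 + `|a| `^ q).
  by rewrite ler_peMr ?mulr_ge0 ?lerDl ?powR_ge0// ltW.
rewrite /lagrangian; lra.
Qed.

(** * Steering the chain of integrators to the origin *)

(** Each derivation lowers the power of [X - c] by only one, leaving a new cofactor; hence the
    generality in [r]. *)
Lemma horner_derivn_expXsubC (R : idomainType) (c : R) (i m : nat)
    (r : {poly R}) : (i < m)%N -> ((('X - c%:P) ^+ m * r)^`(i)).[c] = 0.
Proof.
elim: i m r => [|i IH] [//|m] r im.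
  by rewrite derivn0 exprS -mulrA hornerM hornerXsubC subrr mul0r.
rewrite derivSn derivM deriv_exp derivXsubC mul1r.
have -> : ('X - c%:P) ^+ m.+1.-1 *+ m.+1 * r + ('X - c%:P) ^+ m.+1 * r^`() =
    ('X - c%:P) ^+ m * (r *+ m.+1 + ('X - c%:P) * r^`()).
  by rewrite mulrDr mulrA -exprSr mulrnAl mulrnAr.
exact: IH.
Qed.

(** By Bezout, some multiple of [(X - 1) ^ (n + 1)] is 1 modulo [X ^ (n + 1)]. Multiplied by
    [X ^ k / k!], it has the jet of that monomial at 0 and a zero jet at 1. *)
Lemma hermite_basis (R : realType) (n k : nat) : exists E : {poly R},
  (forall i, (i <= n)%N -> (E^`(i)).[0] = (i == k)%:R) /\
  (forall i, (i <= n)%N -> (E^`(i)).[1] = 0).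
Proof.
have /Bezout_eq1_coprimepP[u uE] :
    coprimep ('X^(n.+1)) (('X - 1%:P) ^+ n.+1 : {poly R}).
  apply: coprimep_expl; apply: coprimep_expr.
  by rewrite coprimep_XsubC rootX oner_eq0.
have {}uE : u.2 * ('X - 1%:P) ^+ n.+1 = 1 - u.1 * 'X^(n.+1) by rewrite -uE addrAC subrr add0r.
exists (u.2 * ('X - 1%:P) ^+ n.+1 * ((k`!%:R)^-1 *: 'X^k)); split => i lein.
  rewrite uE horner_coef0 coef_derivn addn0 ffactnn mulrBl mul1r coefB coefZ coefXn.
  rewrite mulrAC coefMXn ltnS lein subr0.
  have [->|ik] := eqVneq i k; last by rewrite mulr0 mul0rn.
  by rewrite mulr1 -[LHS]mulr_natr mulVf// pnatr_eq0 -lt0n fact_gt0.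
by rewrite [u.2 * _]mulrC -mulrA horner_derivn_expXsubC.
Qed.

Lemma horner_bounded (R : realType) (p : {poly R}) : exists2 K, 0 < K &
  forall t, 0 <= t -> t <= 1 -> `|p.[t]| <= K.
Proof.
elim/poly_ind: p => [|p c [K K0 H]].
  by exists 1 => // t _ _; rewrite horner0 normr0.
exists (K + `|c|) => [|t t0 t1]; first by rewrite ltr_pwDl.
rewrite !hornerE (le_trans (ler_normD _ _))// lerD2r normrM.
rewrite -[K]mulr1 ler_pM//; first exact: H.
by rewrite ger0_norm.
Qed.

Lemma horner_lipschitz (R : realType) (p : {poly R}) : exists2 K, 0 < K &
  forall s t, 0 <= s -> s <= 1 -> 0 <= t -> t <= 1 ->
    `|p.[s] - p.[t]| <= K * `|s - t|.
Proof.
elim/poly_ind: p => [|p c [K K0 H]].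
  by exists 1 => // s t _ _ _ _; rewrite !horner0 subrr normr0 mul1r.
have [M M0 HM] := horner_bounded p.
exists (K + M) => [|s t s0 s1 t0 t1]; first by rewrite addr_gt0.
have -> : (p * 'X + c%:P).[s] - (p * 'X + c%:P).[t] =
    (p.[s] - p.[t]) * s + p.[t] * (s - t) by rewrite !hornerE; ring.
rewrite (le_trans (ler_normD _ _))// [leRHS]mulrDl lerD// normrM.
  rewrite -[leRHS]mulr1 ler_pM//; first exact: H.
  by rewrite ger0_norm.
by rewrite ler_wpM2r// HM.
Qed.

Lemma is_derive_cV (R : realType) (n : nat) (x : R -> 'cV[R]_n.+1) (t : R) (v : 'cV[R]_n.+1) :
  is_derive t 1 x v <-> forall i, is_derive t 1 (fun s => x s i 0) (v i 0).
Proof.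
split=> [xv i|xv].
  apply: DeriveDef.
    by have /derivable_mxP := @ex_derive _ _ _ _ _ _ _ xv; exact.
  have := @derive_mx _ _ _ _ _ _ _ (@ex_derive _ _ _ _ _ _ _ xv).
  by rewrite derive_val => ->; rewrite mxE.
have dx : derivable x t 1.
  by apply/derivable_mxP => i j; rewrite ord1; exact: (@ex_derive _ _ _ _ _ _ _ (xv i)).
apply: DeriveDef => //; rewrite derive_mx//; apply/matrixP => i j.
by rewrite mxE ord1; exact: (@derive_val _ _ _ _ _ _ _ (xv i)).
Qed.

(** The value [inord i.+1] is read only for [i < n], where it is the true successor of [i]. *)
Lemma jordan0_coord (R : realType) (n : nat) (x : 'cV[R]_n.+1) (u : R) i :
  (jordan0 R n *m x + u *: elast R n) i 0 =
  if (i < n)%N then x (inord i.+1) 0 else u.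
Proof.
rewrite !mxE eqxx andbT; have [i_lt|i_ge] := ltnP i n.
  rewrite (bigD1 (inord i.+1)) //= mxE inordK ?ltnS// eqxx mul1r.
  rewrite big1 ?addr0 => [|j ji].
    have -> : (i == ord_max) = false; last by rewrite mulr0 addr0.
    by apply/eqP => /(congr1 val) /= E; rewrite E ltnn in i_lt.
  rewrite mxE (_ : (j == i.+1 :> nat) = false) ?mul0r//.
  by apply: contraNF ji => /eqP ji; apply/eqP/val_inj; rewrite /= inordK.
have -> : i == ord_max.
  by apply/eqP/val_inj/eqP; rewrite eqn_leq i_ge /= -ltnS ltn_ord.
rewrite mulr1 big1 ?add0r// => j _; rewrite mxE.
rewrite (_ : (j == i.+1 :> nat) = false) ?mul0r//.
by rewrite ltn_eqF// (leq_trans (ltn_ord j)).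
Qed.

Lemma has_ae_derivative_lin (R : realType) (n : nat) (a : R)
    (x y v w : R -> 'cV[R]_n.+1) :
  has_ae_derivative x v -> has_ae_derivative y w ->
  has_ae_derivative (fun t => a *: x t + y t) (fun t => a *: v t + w t).
Proof.
move=> [acx dx] [acy dy]; split=> [T T0|].
  exact: (acD (acZ a (acx T T0)) (acy T T0)).
apply: ae_imp2 dx dy => t dx dy t0.
exact: (is_deriveD (is_deriveZ a (dx t0)) (dy t0)).
Qed.

Lemma trajectory_lin (R : realType) (n : nat) (a : R) (x0 y0 : 'cV[R]_n.+1)
    (u w : R -> R) (x y : R -> 'cV[R]_n.+1) :
  trajectory x0 u x -> trajectory y0 w y ->
  trajectory (a *: x0 + y0) (fun t => a * u t + w t) (fun t => a *: x t + y t).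
Proof.
move=> [xE dx] [yE dy]; split; first by rewrite xE yE.
have := has_ae_derivative_lin a dx dy; congr has_ae_derivative.
apply/funext => t; rewrite scalerDr mulmxDr -scalemxAr scalerA scalerDl.
by rewrite addrACA.
Qed.

Lemma trajectory0 (R : realType) (n : nat) :
  trajectory (0 : 'cV[R]_n.+1) (fun=> 0) (fun=> 0).
Proof.
split => //; split=> [T T0|].
  by apply: (lipschitz_ac (ltr01 : 0 < 1 :> R)) => a b _ ab _; rewrite subrr normr0 mul1r subr_ge0.
by apply: aeW => t _; rewrite mulmx0 scale0r addr0; exact: is_derive_cst.
Qed.

(* [x' = J x + e_n v] is a chain of integrators, so a trajectory is the vector of
   successive derivatives of its first coordinate, here a polynomial [E]; since
   these derivatives vanish at 1, freezing the time at 1 prolongs it by 0. *)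
Lemma steering_basis (R : realType) (n : nat) (k : 'I_n.+1) :
  exists (K : R) (v : R -> R) (y : R -> 'cV[R]_n.+1),
  [/\ 0 < K, trajectory (delta_mx k 0) v y, measurable_fun setT v,
      forall t, 0 <= t -> `|v t| <= K /\ `|y t| <= K &
      forall t, 1 <= t -> v t = 0 /\ y t = 0].
Proof.
have [E [E0 E1]] := hermite_basis R n k.
pose y t : 'cV[R]_n.+1 := \col_i (E^`(i)).[Num.min t 1].
pose v t := if t < 1 then (E^`(n.+1)).[t] else 0.
have min01 (t : R) : 0 <= t -> 0 <= Num.min t 1 <= 1.
  by move=> t0; rewrite le_min t0 ler01 ge_min lexx orbT.
have [Kv Kv0 vK] := horner_bounded E^`(n.+1).
have /choice[Ky yK] : forall i : nat, exists K, 0 < K /\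
    forall t, 0 <= t -> t <= 1 -> `|(E^`(i)).[t]| <= K.
  by move=> i; have [K K0 HK] := horner_bounded E^`(i); exists K.
have /choice[L yL] : forall i : nat, exists K, 0 < K /\
    forall s t, 0 <= s -> s <= 1 -> 0 <= t -> t <= 1 ->
    `|(E^`(i)).[s] - (E^`(i)).[t]| <= K * `|s - t|.
  by move=> i; have [K K0 HK] := horner_lipschitz E^`(i); exists K.
have sum_le (f : nat -> R) (i : 'I_n.+1) : (forall i, 0 < f i) ->
    f i <= \sum_(j < n.+1) f j.
  by move=> f0; rewrite (bigD1 i) //= lerDl sumr_ge0// => j _; exact: ltW.
exists (Kv + \sum_(i < n.+1) Ky i), v, y; split.
- rewrite ltr_wpDr// sumr_ge0// => i _; exact/ltW/(yK i).1.
- split.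
    apply/colP => i; rewrite !mxE eqxx andbT.
    by rewrite min_l ?ler01// E0// -ltnS ltn_ord.
  split=> [T T0|].
    have L0 : 0 < \sum_(i < n.+1) L i.
      exact: lt_le_trans (yL ord0).1 (sum_le L ord0 (fun i => (yL i).1)).
    apply: (lipschitz_ac L0) => a b a0 ab _.
    apply: cV_norm_le => i; rewrite !mxE.
    have /andP[a0' a1'] := min01 _ a0.
    have /andP[b0' b1'] := min01 _ (le_trans a0 ab).
    rewrite (le_trans ((yL i).2 _ _ b0' b1' a0' a1'))//.
    rewrite ler_pM ?(ltW (yL i).1) ?sum_le//; first by move=> j; exact: (yL j).1.
    have hmin : Num.min a 1 <= Num.min b 1.
      by rewrite le_min !ge_min ab lexx !orbT.
    rewrite ger0_norm ?subr_ge0//.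
    by rewrite /Num.min; case: ltP => ?; case: ltP => ?; lra.
  apply: ae_imp (ae_neq (1 : R)) => t t1 t0; apply/is_derive_cV => i.
  rewrite jordan0_coord.
  have -> : (if (i < n)%N then y t (inord i.+1) 0 else v t) =
      if t < 1 then (E^`(i.+1)).[t] else 0.
    case: ltnP => [ilt|ige].
      rewrite mxE inordK ?ltnS//; case: ltP => // _.
      by rewrite E1.
    by have -> : nat_of_ord i = n by apply/eqP; rewrite eqn_leq ige -ltnS ltn_ord.
  rewrite derivnS.
  have -> : (fun s => y s i 0) = (fun s => (E^`(i)).[Num.min s 1]).
    by apply/funext => s; rewrite mxE.
  have [tlt|tge] := ltP t 1.
    apply: near_eq_is_derive (is_derive_poly _ _).
    by near=> s; rewrite min_l// ltW//; near: s; exact: lt_nbhsl.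
  have {}tgt : 1 < t by rewrite lt_neqAle eq_sym t1.
  apply: (@near_eq_is_derive _ _ _ (cst 0)) (is_derive_cst _ _ _).
  near=> s; rewrite min_r; last by rewrite ltW//; near: s; exact: lt_nbhsr.
  by rewrite E1// -ltnS ltn_ord.
- apply: measurable_fun_if => //.
    by apply: measurable_fun_ltr.
  apply: measurable_funTS; apply: continuous_measurable_fun.
  exact: continuous_horner.
- move=> t t0; have /andP[a0 a1] := min01 _ t0; split.
    rewrite /v; case: ltP => [tlt|_]; last first.
      by rewrite normr0 addr_ge0//; [exact: ltW|apply: sumr_ge0 => i _; exact/ltW/(yK i).1].
    rewrite (le_trans (vK _ t0 (ltW tlt)))// lerDl sumr_ge0// => i _.
    exact/ltW/(yK i).1.
  apply: cV_norm_le => i; rewrite mxE (le_trans ((yK i).2 _ a0 a1))//.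
  by rewrite ler_wpDl//; [exact: ltW|apply: sum_le => j; exact: (yK j).1].
- move=> t t1; rewrite /v ltNge t1; split => //; apply/colP => i.
  by rewrite !mxE min_r// E1// -ltnS ltn_ord.
Unshelve. all: by end_near. Qed.

(** Superposing the basis solutions makes [v h] and [y h] linear in [h], whence bounds proportional
    to [|h|]. *)
Lemma steering (R : realType) (n : nat) :
  exists (K : R) (v : 'cV[R]_n.+1 -> R -> R) (y : 'cV[R]_n.+1 -> R -> 'cV[R]_n.+1),
  [/\ 0 < K, forall h, trajectory h (v h) (y h) /\ measurable_fun setT (v h),
      forall h t, 0 <= t -> `|v h t| <= K * `|h| /\ `|y h t| <= K * `|h| &
      forall h t, 1 <= t -> v h t = 0 /\ y h t = 0].
Proof.
have /choice[K /choice[v /choice[y H]]] := @steering_basis R n.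
exists (\sum_k K k), (fun h t => \sum_k h k 0 * v k t),
  (fun h t => \sum_k h k 0 *: y k t); split.
- rewrite big_ord_recl ltr_pwDl//; first by have [] := H ord0.
  by apply: sumr_ge0 => i _; have [/ltW] := H (lift ord0 i).
- move=> h; split; last first.
    by apply: measurable_sum => k; apply: measurable_funM => //; have [] := H k.
  rewrite {1}(cV_sum_delta h); elim: (index_enum _) => [|k s IH].
    rewrite big_nil; have := trajectory0 R n; congr trajectory.
      by apply/funext => t; rewrite big_nil.
    by apply/funext => t; rewrite big_nil.
  have [_ tr _ _ _] := H k; have := trajectory_lin (h k 0) tr IH.
  rewrite big_cons; congr trajectory.
    by apply/funext => t; rewrite big_cons.
  by apply/funext => t; rewrite big_cons.
- move=> h t t0; rewrite !mulr_suml; split;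
    rewrite (le_trans (ler_norm_sum _ _ _))//; apply: ler_sum => k _;
    have [_ _ _ /(_ _ t0)[vK yK] _] := H k;
    rewrite ?normrM ?normrZ mulrC ler_pM ?cV_coord_le//.
- by move=> h t t1; split; apply: big1 => k _;
    have [_ _ _ _ /(_ _ t1)[vE yE]] := H k; rewrite ?vE ?yE ?mulr0 ?scaler0.
Qed.

(** * Controls, trajectories and costs *)

Lemma Lq_control_lin (R : realType) (q a : R) (u w : R -> R) : 1 < q ->
  Lq_control q u -> Lq_control q w -> Lq_control q (fun t => a * u t + w t).
Proof.
move=> q1 Lu Lw; have p1 : (1 <= q%:E)%E by rewrite lee_fin ltW.
have [_ /(_ a _ _ Lu Lw) H] := Lfun_submod_closed (@lebesgue_measure R) p1.
rewrite /Lq_control (_ : _ \_ _ = a *: (u \_ `[0, +oo[) + (w \_ `[0, +oo[))//.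
apply/funext => t.
rewrite [RHS]/(a *: (u \_ `[0, +oo[) t + (w \_ `[0, +oo[) t).
rewrite !patchE; case: ifPn => // _. by rewrite scaler0; exact: esym (addr0 _).
Qed.

Lemma Lq_control_measurable (R : realType) (q : R) (u : R -> R) :
  Lq_control q u -> measurable_fun (`[0, +oo[ : set R) u.
Proof.
move=> /andP[+ _]; rewrite inE /= => mu.
by apply/measurable_restrictT.
Qed.

Lemma integral_unit_cst (R : realType) (c : R) :
  (\int[@lebesgue_measure R]_(t in `[0%R, 1%R]) c%:E = c%:E)%E.
Proof.
have := @integral_cst _ _ _ (@lebesgue_measure R) _ (measurable_itv `[0, 1]) c%:E.
move=> /= ->; rewrite lebesgue_measure_itv /= lte_fin ltr01.
by rewrite -EFinD subr0 mule1.
Qed.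

Lemma integral_unit_patch (R : realType) (phi : R -> R) :
  (\int[@lebesgue_measure R]_(t in `[0%R, +oo[) ((phi \_ `[0, 1]) t)%R%:E =
   \int[@lebesgue_measure R]_(t in `[0%R, 1%R]) (phi t)%:E)%E.
Proof.
transitivity (\int[@lebesgue_measure R]_(t in `[0%R, +oo[)
    ((EFin \o phi) \_ `[0%R, 1%R]) t)%E.
  by apply: eq_integral => t _; rewrite restrict_EFin.
rewrite -integral_mkcondr setIidr// => t /=; rewrite !in_itv/= andbT.
by move=> /andP[].
Qed.

Lemma Lq_control_bounded (R : realType) (q K : R) (v : R -> R) : 1 < q ->
  measurable_fun setT v -> (forall t, 0 <= t -> `|v t| <= K) ->
  (forall t, 1 <= t -> v t = 0) -> Lq_control q v.
Proof.
move=> q1 mv vK v0; have q0 : 0 < q by lra.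
have mv' : measurable_fun setT (v \_ `[0, +oo[).
  apply/(measurable_restrictT v (measurable_itv `[0, +oo[)).
  exact: measurable_funTS.
apply/andP; split; first by rewrite inE.
rewrite inE /= /finite_norm unlock /Lnorm; apply: poweR_lty.
have K0 : 0 <= K by exact: le_trans (vK 0 (lexx _)).
pose c := K `^ q; have c0 : 0 <= c by exact: powR_ge0.
apply: (@le_lt_trans _ _ (\int[@lebesgue_measure R]_x
    ((cst c \_ `[0, 1]) x)%R%:E)%E); last first.
  rewrite (_ : \int[_]_x _ = \int[@lebesgue_measure R]_x
      ((EFin \o cst c) \_ `[0%R, 1%R]) x)%E; last first.
    by apply: eq_integral => t _; rewrite restrict_EFin.
  by rewrite -integral_mkcond [X in (X < _)%E]integral_unit_cst ltry.
apply: ge0_le_integral => //.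
- by move=> t _; exact: poweR_ge0.
- apply/measurable_EFinP.
  apply: (@measurableT_comp _ _ _ _ _ _ (@powR R ^~ q)) => //.
  exact: measurableT_comp.
- apply/measurable_EFinP.
  by apply/(measurable_restrictT (cst c) (measurable_itv `[0, 1])).
move=> t _; rewrite /= lee_fin !patchE.
case: ifPn => [|_]; last first.
  by rewrite normr0 powR0 ?gt_eqF//; case: ifP.
rewrite inE /= in_itv/= andbT => t0.
have [t1|t1] := leP t 1; last first.
  by rewrite (v0 _ (ltW t1)) normr0 powR0 ?gt_eqF//; case: ifP.
rewrite mem_set; last by rewrite /= in_itv/= t0 t1.
by apply: ge0_ler_powR; rewrite ?nnegrE ?(ltW q0)// vK.
Qed.

Lemma ac_continuous_half (R : realType) (V : normedModType R) (x : R -> V) :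
  (forall T, 0 < T -> ac T x) -> {within `[0, +oo[, continuous x}.
Proof.
move=> acx; apply/subspace_continuousP => t /=; rewrite in_itv/= andbT => t0.
have t10 : 0 < t + 1 by lra.
apply/cvgrPdist_lt => e e0; have [d d0 H] := ac_dist (acx _ t10) e0.
rewrite near_withinE; apply/nbhs_ballP; exists (Num.min d 1).
  by rewrite /= lt_min d0 ltr01.
move=> s; rewrite -ball_normE /= in_itv/= andbT lt_min => /andP[sd s1] s0.
apply: H => //; first by rewrite lerDl.
by move: s1; rewrite distrC ltr_distl => /andP[_ /ltW].
Qed.

Lemma trajectory_continuous (R : realType) (n : nat) (x0 : 'cV[R]_n.+1)
    (u : R -> R) (x : R -> 'cV[R]_n.+1) :
  trajectory x0 u x -> {within `[0, +oo[, continuous x}.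
Proof. by move=> [_ [acx _]]; exact: ac_continuous_half. Qed.

Lemma measurable_lagrangian (R : realType) (n : nat) (q : R)
    (F : 'cV[R]_n.+1 -> R) (u : R -> R) (x : R -> 'cV[R]_n.+1) :
  continuous F -> measurable_fun (`[0, +oo[ : set R) u ->
  {within `[0, +oo[, continuous x} ->
  measurable_fun (`[0, +oo[ : set R) (fun t => lagrangian q F (u t) (x t)).
Proof.
move=> cF mu cx; apply: measurable_funD.
  apply: measurable_funM => //.
  apply: (@measurableT_comp _ _ _ _ _ _ (@powR R ^~ q)) => //.
  exact: measurableT_comp.
apply: subspace_continuous_measurable_fun => //.
by apply: (@within_continuous_comp _ _ _ _ x F) => // y _; exact: cF.
Qed.

Lemma ac_norm_le (R : realType) (f g : R -> R) : ac 1 f ->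
  (@lebesgue_measure R).-integrable `[0, 1] (EFin \o g) ->
  {ae (@lebesgue_measure R), forall t : R, 0 <= t -> is_derive t 1 f (g t)} ->
  forall t, 0 <= t -> t <= 1 ->
    `|f t| <= `|f 0| + \int[@lebesgue_measure R]_(s in `[0, 1]) `|g s|.
Proof.
move=> acf ig fg t t0 t1.
have ign : (@lebesgue_measure R).-integrable `[0, 1] (fun s => `|g s|%:E).
  exact: integrable_norm ig.
move: t0; rewrite le_eqVlt => /predU1P[<-|t0].
  by rewrite lerDl; exact: Rintegral_ge0.
have sub : `[0, t] `<=` `[0, 1 : R] by apply: subset_itvl; rewrite bnd_simp.
have igt : (@lebesgue_measure R).-integrable `[0, t] (EFin \o g).
  exact: integrableS ig.
have ignt : (@lebesgue_measure R).-integrable `[0, t] (fun s => `|g s|%:E).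
  exact: integrableS ign.
have := ac_ftc t0 (acS t1 acf) igt; set I := Rintegral _ _ _ => /(_ _)/wrap[].
  by apply: ae_imp fg => s fs s0 _; apply: fs; exact: ltW.
move=> /eqP; rewrite subr_eq addrC => /eqP ->.
rewrite (le_trans (ler_normD _ _))// lerD2l.
rewrite (le_trans (le_normr_Rintegral _ igt))//.
rewrite -lee_fin /Rintegral !fineK; [|exact: integrable_fin_num ign|exact: integrable_fin_num ignt].
apply: ge0_subset_integral => //.
exact: measurable_int ign.
Qed.

(* Coordinate [i] is an integral of coordinate [i + 1], and the last one of [u]:
   descending on [i], no Gronwall argument is needed. *)
Lemma trajectory_bound (R : realType) (n : nat) (x0 : 'cV[R]_n.+1)
    (u : R -> R) (x : R -> 'cV[R]_n.+1) :
  trajectory x0 u x ->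
  (@lebesgue_measure R).-integrable `[0, 1] (EFin \o u) ->
  forall t, 0 <= t -> t <= 1 -> `|x t| <=
    n.+1%:R * `|x0| + \int[@lebesgue_measure R]_(s in `[0, 1]) `|u s|.
Proof.
move=> [xE [acx dx]] iu; set M := Rintegral _ _ _.
have {}dx i : {ae (@lebesgue_measure R), forall t : R, 0 <= t ->
    is_derive t 1 (fun s => x s i 0) (if (i < n)%N then x t (inord i.+1) 0 else u t)}.
  apply: ae_imp dx => t dx t0; have /is_derive_cV/(_ i) := dx t0.
  by rewrite jordan0_coord.
have acxi i : ac 1 (fun s => x s i 0) by apply: ac_coord; exact: acx.
have x0i i : `|x 0 i 0| <= `|x0| by rewrite xE; exact: cV_coord_le.
(* Here [k] counts the coordinates after [i]. Each integration adds one initial value, at most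
   [|x0|], and multiplies nothing, the interval having length 1. *)
have claim (k : nat) (i : 'I_n.+1) : (i + k = n)%N -> forall t, 0 <= t -> t <= 1 ->
    `|x t i 0| <= k.+1%:R * `|x0| + M.
  elim: k i => [|k IH] i ik t t0 t1.
    have := ac_norm_le (g := u) (acxi i) iu.
    rewrite -/M => /(_ _ t t0 t1); rewrite mul1r => H.
    apply: (le_trans (H _)); last by rewrite lerD2r.
    have iN : (i < n)%N = false.
      by lia.
    by apply: ae_imp (dx i) => s /[swap] s0 /(_ s0); rewrite iN.
  have i_lt : (i < n)%N by lia.
  pose j : 'I_n.+1 := inord i.+1.
  have jk : (j + k = n)%N by rewrite inordK; lia.
  have ij : (@lebesgue_measure R).-integrable `[0, 1] (EFin \o (fun s => x s j 0)).
    apply: continuous_compact_integrable; first exact: segment_compact.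
    exact: ac_continuous.
  have := ac_norm_le (acxi i) ij => /(_ _ t t0 t1) H.
  apply: (le_trans (H _)).
    by apply: ae_imp (dx i) => s /[swap] s0 /(_ s0); rewrite i_lt.
  rewrite -[k.+2]addn1 natrD mulrDl mul1r addrAC addrC lerD//.
  rewrite (@le_trans _ _ (\int[@lebesgue_measure R]_(s in `[0, 1])
      (k.+1%:R * `|x0| + M)))//.
    apply: le_Rintegral => //; first exact: integrable_norm ij.
      apply: continuous_compact_integrable; first exact: segment_compact.
      exact: cst_continuous.
    by move=> s /=; rewrite in_itv/= => /andP[s0 s1]; exact: IH.
  by rewrite /Rintegral integral_unit_cst.
move=> t t0 t1; apply: cV_norm_le => i.
have ik : (i + (n - i) = n)%N by rewrite subnKC// -ltnS ltn_ord.
rewrite (le_trans (claim _ _ ik t t0 t1))// lerD2r ler_wpM2r// ler_nat ltnS.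
exact: leq_subr.
Qed.

(** Pointwise [|u| <= 1 + |u| ^ q], which is at most 1 plus [q] times the Lagrangian; integrate over
    [0, 1]. *)
Lemma cost_control_bound (R : realType) (n : nat) (q c : R)
    (F : 'cV[R]_n.+1 -> R) (x0 : 'cV[R]_n.+1) (u : R -> R)
    (x : R -> 'cV[R]_n.+1) : 1 < q -> continuous F -> (forall y, 0 <= F y) ->
  admissible q x0 u x -> (cost q F u x <= c%:E)%E ->
  (@lebesgue_measure R).-integrable `[0, 1] (EFin \o u) /\
  \int[@lebesgue_measure R]_(s in `[0, 1]) `|u s| <= 1 + q * c.
Proof.
move=> q1 cF F0 [Lu tr] costc; have q0 : 0 < q by lra.
have sub : `[0, 1] `<=` (`[0, +oo[ : set R).
  by move=> t /=; rewrite !in_itv/= andbT => /andP[].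
have mu := Lq_control_measurable Lu.
have mu1 : measurable_fun (`[0, 1] : set R) u by exact: measurable_funS mu.
have mL := measurable_lagrangian q cF mu (trajectory_continuous tr).
have L0 t : 0 <= lagrangian q F (u t) (x t).
  by rewrite addr_ge0// divr_ge0 ?powR_ge0// ltW.
have bound : (\int[@lebesgue_measure R]_(s in `[0%R, 1%R]) `|u s|%:E <=
    (1 + q * c)%:E)%E.
  apply: (@le_trans _ _ (\int[@lebesgue_measure R]_(s in `[0%R, 1%R])
      (1%:E + q%:E * (lagrangian q F (u s) (x s))%:E))%E).
    apply: ge0_le_integral => //.
    - by apply/measurable_EFinP; exact: measurableT_comp.
    - apply/measurable_EFinP; apply: measurable_funD => //.
      by apply: measurable_funM => //; exact: measurable_funS mL.
    move=> t _; rewrite lee_fin /lagrangian mulrDr mulrC divfK ?gt_eqF//.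
    rewrite addrA ler_wpDr ?mulr_ge0 ?(ltW q0)//.
    have [u1|u1] := leP `|u t| 1; first by rewrite ler_wpDr ?powR_ge0.
    by rewrite ler_wpDl// le1r_powR ?ltW.
  rewrite ge0_integralD//; last 2 first.
  - by move=> t _; rewrite -EFinM lee_fin mulr_ge0// ltW.
  - apply/measurable_EFinP.
    by apply: measurable_funM => //; exact: measurable_funS mL.
  rewrite integral_unit_cst EFinD leeD2l// ge0_integralZl_EFin//; last 3 first.
  - by move=> t _; rewrite lee_fin.
  - by apply/measurable_EFinP; exact: measurable_funS mL.
  - exact: ltW.
  rewrite EFinM lee_wpmul2l ?lee_fin ?(ltW q0)//.
  apply: le_trans costc; apply: ge0_subset_integral => //.
  - exact/measurable_EFinP.
  - by move=> t _; rewrite lee_fin; exact: L0.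
have iu : (@lebesgue_measure R).-integrable `[0, 1] (EFin \o u).
  apply/integrableP; split; first exact/measurable_EFinP.
  exact: le_lt_trans bound (ltry _).
split => //; rewrite -lee_fin /Rintegral fineK//.
exact: integrable_fin_num (integrable_norm iu).
Qed.

(** Nonnegative integrands and extended reals allow comparing costs before they are known to be
    finite. The factor [a] absorbs errors proportional to the Lagrangian. *)
Lemma integral_half_line_le (R : realType) (f g h : R -> R) (a : R) :
  measurable_fun (`[0, +oo[ : set R) f -> measurable_fun (`[0, +oo[ : set R) g ->
  measurable_fun (`[0, +oo[ : set R) h ->
  (forall t, 0 <= t -> 0 <= f t) -> (forall t, 0 <= t -> 0 <= g t) ->
  (forall t, 0 <= t -> 0 <= h t) -> 0 <= a ->
  (forall t, 0 <= t -> f t <= a * g t + h t) ->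
  (\int[@lebesgue_measure R]_(t in `[0%R, +oo[) (f t)%:E <=
   a%:E * \int[@lebesgue_measure R]_(t in `[0%R, +oo[) (g t)%:E +
   \int[@lebesgue_measure R]_(t in `[0%R, +oo[) (h t)%:E)%E.
Proof.
move=> mf mg mh f0 g0 h0 a0 fgh.
have D0 t : t \in (`[0, +oo[ : interval R) -> 0 <= t by rewrite in_itv/= andbT.
rewrite -ge0_integralZl_EFin//; last 2 first.
- by move=> t /D0 t0; rewrite lee_fin g0.
- exact/measurable_EFinP.
rewrite -ge0_integralD//; last 4 first.
- by move=> t /D0 t0; rewrite -EFinM lee_fin mulr_ge0// g0.
- by apply/measurable_EFinP; apply: measurable_funM.
- by move=> t /D0 t0; rewrite lee_fin h0.
- exact/measurable_EFinP.
apply: ge0_le_integral => //.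
- by move=> t /D0 t0; rewrite lee_fin f0.
- exact/measurable_EFinP.
- by apply/measurable_EFinP; apply: measurable_funD => //; apply: measurable_funM.
- by move=> t /D0 t0; rewrite -EFinM -EFinD lee_fin fgh.
Qed.

Lemma measurable_unit_patch (R : realType) (phi : R -> R) :
  measurable_fun (`[0, 1] : set R) phi ->
  measurable_fun (`[0, +oo[ : set R) (phi \_ `[0, 1]).
Proof.
move=> mphi; apply: measurable_funTS.
exact/(measurable_restrictT phi (measurable_itv `[0, 1])).
Qed.

Lemma unit_patchE (R : realType) (phi : R -> R) t :
  (phi \_ `[0, 1]) t = if (0 <= t) && (t <= 1) then phi t else 0.
Proof. by rewrite patchE mem_setE in_itv. Qed.

Lemma lagrangian_ge0 (R : realType) (n : nat) (q : R) (F : 'cV[R]_n.+1 -> R)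
    u x : 0 < q -> (forall y, 0 <= F y) -> 0 <= lagrangian q F u x.
Proof. by move=> q0 F0; rewrite addr_ge0// divr_ge0 ?powR_ge0// ltW. Qed.

Lemma powR_le_lagrangian (R : realType) (n : nat) (q : R)
    (F : 'cV[R]_n.+1 -> R) u x : 0 < q -> (forall y, 0 <= F y) ->
  `|u| `^ q <= q * lagrangian q F u x.
Proof.
move=> q0 F0; rewrite /lagrangian mulrDr mulrC divfK ?gt_eqF//.
by rewrite lerDl mulr_ge0// ltW.
Qed.

Lemma admissible_measurable (R : realType) (n : nat) (q : R)
    (F : 'cV[R]_n.+1 -> R) x0 u x : continuous F -> admissible q x0 u x ->
  measurable_fun (`[0, +oo[ : set R) (fun t => lagrangian q F (u t) (x t)).
Proof.
move=> cF [Lu tr]; apply: measurable_lagrangian => //.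
  exact: Lq_control_measurable Lu.
exact: trajectory_continuous tr.
Qed.

(** An optimal control is tied to its costate only almost everywhere; this permits replacing it by
    the pointwise formula inside the cost. *)
Lemma cost_ae (R : realType) (n : nat) (q : R) (F : 'cV[R]_n.+1 -> R)
    (u w : R -> R) (x : R -> 'cV[R]_n.+1) : continuous F ->
  measurable_fun (`[0, +oo[ : set R) u -> measurable_fun (`[0, +oo[ : set R) w ->
  {within `[0, +oo[, continuous x} ->
  {ae (@lebesgue_measure R), forall t, 0 <= t -> u t = w t} ->
  cost q F u x = cost q F w x.
Proof.
move=> cF mu mw cx uw; apply: ae_eq_integral => //.
- by apply/measurable_EFinP; exact: measurable_lagrangian.
- by apply/measurable_EFinP; exact: measurable_lagrangian.
by apply: ae_imp uw => t uw; rewrite /= in_itv/= andbT => /uw ->.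
Qed.

Lemma admissible_lin (R : realType) (n : nat) (q a : R)
    (x0 y0 : 'cV[R]_n.+1) u w x y : 1 < q ->
  admissible q x0 u x -> admissible q y0 w y ->
  admissible q (a *: x0 + y0) (fun t => a * u t + w t) (fun t => a *: x t + y t).
Proof.
move=> q1 [Lu tu] [Lw tw]; split; first exact: Lq_control_lin.
exact: trajectory_lin.
Qed.

(** * Duality between state and costate *)

Lemma dotpE (R : realType) (n : nat) (c h : 'cV[R]_n.+1) :
  dotp c h = (c^T *m h) 0 0.
Proof. by rewrite !mxE; apply: eq_bigr => i _; rewrite mxE. Qed.

Lemma is_derive_dotp (R : realType) (n : nat) (x y : R -> 'cV[R]_n.+1)
    (t : R) (v w : 'cV[R]_n.+1) : is_derive t 1 x v -> is_derive t 1 y w ->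
  is_derive t 1 (fun s => dotp (x s) (y s)) (dotp v (y t) + dotp (x t) w).
Proof.
move=> /is_derive_cV xv /is_derive_cV yw.
have xy i : is_derive t 1 ((fun s => x s i 0) * (fun s => y s i 0))
    (x t i 0 *: w i 0 + y t i 0 *: v i 0) by exact: is_deriveM.
have := is_derive_sum xy.
rewrite (_ : \sum_(i < n.+1) _ = fun s => dotp (x s) (y s)); last first.
  by apply/funext => s; rewrite fct_sumE.
move=> H; apply: (is_derive_eq H).
rewrite /dotp -big_split; apply: eq_bigr => i _ /=.
by rewrite addrC; congr (_ + _); rewrite [LHS]mulrC.
Qed.

(** The two terms in the Jordan block are adjoint and cancel, so the derivative of [<p, y>] reduces
    to the first variation of the Lagrangian. *)
Lemma hamiltonian_dotp (R : realType) (n : nat) (p g y : 'cV[R]_n.+1) (v : R) :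
  dotp (- ((jordan0 R n)^T *m p) + g) y + dotp p (jordan0 R n *m y + v *: elast R n) =
  p ord_max 0 * v + dotp g y.
Proof.
rewrite !dotpE linearD linearN /= mulmxDl mulNmx mulmxDr -scalemxAr trmx_mul trmxK.
rewrite mulmxA.
have -> : (p^T *m elast R n) = (p ord_max 0)%:M.
  apply/matrixP => i j; rewrite !ord1 !mxE (bigD1 ord_max)//= !mxE !eqxx mulr1.
  rewrite big1 ?addr0 ?mulr1n// => k /negbTE kn; rewrite !mxE kn mulr0//.
rewrite !mxE mulr1n; ring.
Qed.

Lemma ac_dotp (R : realType) (n : nat) (T : R) (x y : R -> 'cV[R]_n.+1) :
  0 <= T -> ac T x -> ac T y -> ac T (fun t => dotp (x t) (y t)).
Proof.
move=> T0 acx acy; rewrite /dotp; elim: (index_enum _) => [|i s IH].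
  apply: (lipschitz_ac ltr01) => a b _ ab _.
  by rewrite !big_nil subrr normr0 mul1r subr_ge0.
under eq_fun do rewrite big_cons.
exact: (acD (acM T0 (ac_coord i acx) (ac_coord i acy)) IH).
Qed.

Lemma within_unit_bounded (R : realType) (V : normedModType R) (f : R -> V) :
  {within `[0, 1], continuous f} ->
  exists2 M, 0 < M & forall t, 0 <= t -> t <= 1 -> `|f t| <= M.
Proof.
move=> cf; have := continuous_compact cf (@segment_compact _ 0 1).
move=> /compact_bounded[M [_ HM]]; exists (Num.max (M + 1) 1).
  by rewrite lt_max ltr01 orbT.
move=> t t0 t1; apply: HM; first by rewrite lt_max ltrDl ltr01.
by exists t => //=; rewrite in_itv/= t0 t1.
Qed.

Lemma measurable_coord (R : realType) (n : nat) (A : set R)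
    (x : R -> 'cV[R]_n.+1) i : measurable A -> {within A, continuous x} ->
  measurable_fun A (fun t => x t i 0).
Proof.
move=> mA cx; apply: subspace_continuous_measurable_fun => //.
apply: (@within_continuous_comp _ _ _ _ x (fun z : 'cV[R]_n.+1 => z i 0)) => //.
by move=> z _; exact: coord_continuous.
Qed.

Lemma costate_duality (R : realType) (n : nat) (F : 'cV[R]_n.+1 -> R)
    (x p y : R -> 'cV[R]_n.+1) (h : 'cV[R]_n.+1) (v : R -> R) :
  (forall T, 0 < T -> ac T p) ->
  {ae (@lebesgue_measure R), forall t : R, 0 <= t -> is_derive t 1 p
     (- ((jordan0 R n)^T *m p t) + grad F (x t))} ->
  trajectory h v y -> y 1 = 0 ->
  (@lebesgue_measure R).-integrable `[0, 1]
    (EFin \o (fun t => p t ord_max 0 * v t + dotp (grad F (x t)) (y t))) ->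
  \int[@lebesgue_measure R]_(t in `[0, 1])
     (p t ord_max 0 * v t + dotp (grad F (x t)) (y t)) = - dotp (p 0) h.
Proof.
move=> acp dp [yh [acy dy]] y1 ig.
have acpy : ac 1 (fun t => dotp (p t) (y t)).
  by apply: ac_dotp => //; [exact: acp|exact: acy].
have := ac_ftc ltr01 acpy ig => /(_ _)/wrap[].
  apply: ae_imp2 dp dy => t dp dy t0 _.
  have := is_derive_dotp (dp (ltW t0)) (dy (ltW t0)).
  by rewrite hamiltonian_dotp.
by move=> <-; rewrite y1 yh linear0 sub0r.
Qed.

(** Both equations give the derivative of the same [x]; cancelling the Jordan term and reading the
    last coordinate isolates the control. *)
Lemma optimal_control_costate (R : realType) (n : nat) (q : R)
    (x0 : 'cV[R]_n.+1) (u : R -> R) (x p : R -> 'cV[R]_n.+1) :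
  trajectory x0 u x ->
  has_ae_derivative x (fun t =>
    jordan0 R n *m x t + sgn_powR (p t ord_max 0) (q - 1)^-1 *: elast R n) ->
  {ae (@lebesgue_measure R), forall t, 0 <= t ->
     u t = sgn_powR (p t ord_max 0) (q - 1)^-1}.
Proof.
move=> [_ [_ dx]] [_ dx']; apply: ae_imp2 dx dx' => t dx dx' t0.
have := @derive_val _ _ _ _ _ _ _ (dx t0).
rewrite (@derive_val _ _ _ _ _ _ _ (dx' t0)) => /addrI /colP /(_ ord_max).
by rewrite !mxE !eqxx !mulr1.
Qed.

(** * The value function *)

Lemma cost_ge0 (R : realType) (n : nat) (q : R) (F : 'cV[R]_n.+1 -> R) u x :
  0 < q -> (forall y, 0 <= F y) -> (0 <= cost q F u x)%E.
Proof.
by move=> q0 F0; apply: integral_ge0 => t _; rewrite lee_fin; exact: lagrangian_ge0.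
Qed.

Lemma value_ge0 (R : realType) (n : nat) (q : R) (F : 'cV[R]_n.+1 -> R) x0 :
  0 < q -> (forall y, 0 <= F y) -> (0 <= value q F x0)%E.
Proof.
by move=> q0 F0; apply: le_ereal_inf_tmp => _ [u [x [_ ->]]]; exact: cost_ge0.
Qed.

Lemma value_le_cost (R : realType) (n : nat) (q : R) (F : 'cV[R]_n.+1 -> R)
    x0 u x : admissible q x0 u x -> (value q F x0 <= cost q F u x)%E.
Proof. by move=> adm; apply: ereal_inf_lbound; exists u, x. Qed.

Lemma value_approx (R : realType) (n : nat) (q : R) (F : 'cV[R]_n.+1 -> R) x0 :
  value q F x0 \is a fin_num -> forall e, 0 < e -> exists u x,
    admissible q x0 u x /\ (cost q F u x <= (fine (value q F x0) + e)%:E)%E.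
Proof.
move=> vf e e0; have [_ [u [x [adm ->]]] H] := lb_ereal_inf_adherent e0 vf.
by exists u, x; split => //; rewrite EFinD fineK// ltW.
Qed.

Lemma steering_finite_cost (R : realType) (n : nat) (q : R)
    (F : 'cV[R]_n.+1 -> R) h (v : R -> R) (y : R -> 'cV[R]_n.+1) (K : R) :
  1 < q -> continuous F -> (forall y, 0 <= F y) -> F 0 = 0 ->
  admissible q h v y -> (forall t, 0 <= t -> `|v t| <= K) ->
  (forall t, 1 <= t -> v t = 0 /\ y t = 0) -> (cost q F v y < +oo)%E.
Proof.
move=> q1 cF F0 F00 adm vK vy0; have q0 : 0 < q by lra.
have K0 : 0 <= K by exact: le_trans (vK 0 (lexx _)).
have cy : {within `[0, 1], continuous (F \o y)}.
  apply: within_continuous_comp; first by move=> z _; exact: cF.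
  by apply: ac_continuous; apply: adm.2.2.1.
have [M M0 FM] := within_unit_bounded cy.
pose c := K `^ q / q + M.
have c0 : 0 <= c by rewrite addr_ge0 ?divr_ge0 ?powR_ge0 ?ltW.
apply: (@le_lt_trans _ _ (\int[@lebesgue_measure R]_(t in `[0%R, +oo[)
    ((cst c \_ `[0, 1]) t)%R%:E)%E); last first.
  by rewrite integral_unit_patch integral_unit_cst ltry.
apply: ge0_le_integral => //.
- by move=> t _; rewrite lee_fin; exact: lagrangian_ge0.
- by apply/measurable_EFinP; exact: admissible_measurable adm.
- by apply/measurable_EFinP; exact: measurable_unit_patch.
move=> t; rewrite /= in_itv/= andbT => t0; rewrite lee_fin unit_patchE t0/=.
have [t1|/ltW t1] := leP t 1.
  rewrite lerD//; last by rewrite (le_trans (ler_norm _))// FM.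
  rewrite ler_pM2r ?invr_gt0//.
  by apply: ge0_ler_powR; rewrite ?nnegrE ?(ltW q0)// vK.
have [-> ->] := vy0 t t1.
by rewrite normr0 powR0 ?gt_eqF// mul0r F00 addr0.
Qed.

(** The dynamics are linear and the Lagrangian is jointly convex, so mixing nearly optimal pairs
    costs at most the mixture of their costs. *)
Lemma value_convex (R : realType) (n : nat) (q : R) (F : 'cV[R]_n.+1 -> R) :
  1 < q -> continuous F -> (forall y, 0 <= F y) -> convexR F ->
  (forall x0, value q F x0 \is a fin_num) -> convexR (fine \o value q F).
Proof.
move=> q1 cF F0 cvF vf x1 x2 s s0 s1; have q0 : 0 < q by lra.
rewrite /=; apply/ler_addgt0Pr => e e0.
have [u1 [y1 [a1 c1]]] := value_approx (vf x1) e0.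
have [u2 [y2 [a2 c2]]] := value_approx (vf x2) e0.
(* Only the first pair is scaled by [admissible_lin]; adding the zero pair scales the second one. *)
have a2' : admissible q ((1 - s) *: x2 + 0) (fun t => (1 - s) * u2 t + 0)
    (fun t => (1 - s) *: y2 t + 0).
  apply: admissible_lin => //; split; last exact: trajectory0.
  by apply: (@Lq_control_bounded _ _ 0) => // t _; rewrite normr0.
have a3 := admissible_lin s q1 a1 a2'.
rewrite addr0 in a3.
rewrite -lee_fin fineK//; apply: (le_trans (value_le_cost F a3)).
apply: (@le_trans _ _ (s%:E * cost q F u1 y1 + (1 - s)%:E * cost q F u2 y2)%E).
  have := @integral_half_line_le _
    (fun t => lagrangian q F (s * u1 t + ((1 - s) * u2 t + 0)) (s *: y1 t + ((1 - s) *: y2 t + 0)))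
    (fun t => lagrangian q F (u1 t) (y1 t))
    (fun t => (1 - s) * lagrangian q F (u2 t) (y2 t)) s.
  have m1 := admissible_measurable cF a1; have m2 := admissible_measurable cF a2.
  have m3 := admissible_measurable cF a3.
  have s1' : 0 <= 1 - s by rewrite subr_ge0.
  rewrite [X in (_ + X)%E](_ : _ = ((1 - s)%:E * cost q F u2 y2)%E); last first.
    rewrite /cost -ge0_integralZl_EFin//.
    - by move=> t _; rewrite lee_fin; exact: lagrangian_ge0.
    - exact/measurable_EFinP.
  apply => //.
  - exact: measurable_funM.
  - by move=> t _; exact: lagrangian_ge0.
  - by move=> t _; exact: lagrangian_ge0.
  - by move=> t _; rewrite mulr_ge0// lagrangian_ge0.
  move=> t _; rewrite !addr0 /lagrangian !mulrDr addrACA lerD//.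
    (* In the weighted sum of the tangent inequalities at [m], the first-order terms cancel. *)
    set a := u1 t; set b := u2 t; set m := s * a + (1 - s) * b.
    have := powR_tangent m a q1; have := powR_tangent m b q1.
    move=> /(ler_wpM2l s1') hb /(ler_wpM2l s0) ha.
    have := lerD ha hb; rewrite [leLHS](_ : _ = `|m| `^ q / q)//.
    by rewrite /m; ring.
  exact: cvF.
have := lee_wpmul2l (_ : (0 <= s%:E)%E) c1; rewrite lee_fin => /(_ s0) h1.
have := lee_wpmul2l (_ : (0 <= (1 - s)%:E)%E) c2; rewrite lee_fin subr_ge0 => /(_ s1) h2.
apply: (le_trans (leeD h1 h2)); rewrite -!EFinM -EFinD lee_fin; lra.
Qed.

(** An integrable form of the estimate: the error is now a constant plus a multiple of the
    Lagrangian, whose integral is the cost. *)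
Lemma lagrangian_upper_ball (R : realType) (n : nat) (q : R)
    (F : 'cV[R]_n.+1 -> R) : 1 < q -> continuously_differentiable F ->
  convexR F -> (forall y, 0 <= F y) ->
  forall B e, 0 < e -> exists2 d, 0 < d & forall k a x w z,
    `|x| <= B -> k <= d -> `|w| <= k -> `|z| <= k ->
    lagrangian q F (a + w) (x + z) <=
      lagrangian q F a x + (sgn_powR a (q - 1) * w + dotp (grad F x) z) +
      2 * e * k * (1 + q * lagrangian q F a x).
Proof.
move=> q1 C1F cvF F0 B e e0; have q0 : 0 < q by lra.
have [d d0 H] := lagrangian_upper q1 C1F cvF B e0.
exists d => // k a x w z xB kd wk zk.
rewrite (le_trans (H _ _ _ _ xB (le_trans wk kd) (le_trans zk kd)))// lerD2l.
apply: ler_pM; first by rewrite mulr_ge0 ?addr_ge0// ltW.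
- by rewrite addr_ge0 ?powR_ge0.
- by rewrite (mulrC 2) -!mulrA ler_pM2l//; lra.
- by rewrite lerD2l; exact: powR_le_lagrangian.
Qed.

Lemma value_second_difference (R : realType) (n : nat) (q : R)
    (F : 'cV[R]_n.+1 -> R) : 1 < q -> continuously_differentiable F ->
  convexR F -> (forall y, 0 <= F y) ->
  (forall x0, value q F x0 \is a fin_num) -> let V := fine \o value q F in
  forall x0 e, 0 < e -> exists2 d, 0 < d & forall h, `|h| <= d ->
    V (x0 + h) + V (x0 - h) <= V x0 + V x0 + e * `|h|.
Proof.
move=> q1 C1F cvF F0 vf V x0 e e0; have q0 : 0 < q by lra.
have cF : continuous F by move=> z; apply: differentiable_continuous; exact: C1F.1.
have V0 : 0 <= V x0 by apply: fine_ge0; exact: value_ge0.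
have [K [v [y [K0 tr vyK vy0]]]] := steering R n.
have Lv h : Lq_control q (v h).
  apply: (Lq_control_bounded q1 (tr h).2 (K := K * `|h|)) => t t0.
    by have [] := vyK h t t0.
  by have [] := vy0 h t t0.
(* All competitors below have slack at most 1; this common cost level makes [B], and so [d],
   independent of the chosen pair. *)
pose c := V x0 + 1.
have c0 : 0 < 1 + q * c by rewrite ltr_pwDl// mulr_ge0 ?addr_ge0// ltW.
pose B := n.+1%:R * `|x0| + (1 + q * c).
(* Chosen to give [etaE]. The 4 is the factor 2 of [lagrangian_upper_ball], once for each of the two
   perturbations. *)
pose e' := e / (4 * K * (1 + q * c)).
have e'0 : 0 < e' by rewrite divr_gt0// !mulr_gt0.
have [d d0 Hd] := lagrangian_upper_ball q1 C1F cvF F0 B e'0.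
exists (d / K) => [|h hd]; first by rewrite divr_gt0.
have kd : K * `|h| <= d by rewrite mulrC -ler_pdivlMr.
pose eta := 4 * e' * (K * `|h|).
have eta0 : 0 <= eta.
  by apply: mulr_ge0; apply: mulr_ge0 => //; exact: ltW.
have etaE : eta * (1 + q * c) = e * `|h|.
  rewrite /eta /e'; have : 1 + q * c != 0 by rewrite gt_eqF.
  by have := lt0r_neq0 K0; move: (1 + q * c) => s K1 s1; field; rewrite K1 s1.
suff main r : 0 < r -> r <= 1 ->
    V (x0 + h) + V (x0 - h) <= (2 + eta * q) * (V x0 + r) + eta.
  (* The slack is counted twice, hence [r / 2]; the cap 1 keeps the pair below the level [c]. *)
  apply/ler_addgt0Pr => r r0; pose r' := Num.min (r / 2) 1.
  have r'0 : 0 < r' by rewrite lt_min divr_gt0/=.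
  have r'1 : r' <= 1 by rewrite ge_min lexx orbT.
  have r'r : r' <= r / 2 by rewrite ge_min lexx.
  rewrite (le_trans (main _ r'0 r'1))// -etaE.
  have : eta * q * (V x0 + r') <= eta * q * c.
    by apply: ler_wpM2l; [rewrite mulr_ge0// ltW|rewrite /c lerD2l].
  lra.
move=> r0 r1; have [u [x [adm costr]]] := value_approx (vf x0) r0.
have costc : (cost q F u x <= c%:E)%E.
  by rewrite (le_trans costr)// lee_fin /c /V /= lerD2l.
have [iu ub] := cost_control_bound q1 cF F0 adm costc.
have xB t : 0 <= t -> t <= 1 -> `|x t| <= B.
  move=> t0 t1; rewrite (le_trans (trajectory_bound adm.2 iu t0 t1))//.
  by rewrite lerD2l.
have admv : admissible q h (v h) (y h) by split; [exact: Lv|exact: (tr h).1].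
have admp := admissible_lin 1 q1 adm admv.
have admm := admissible_lin (-1) q1 admv adm.
rewrite scale1r in admp; rewrite scaleN1r addrC in admm.
pose Lp t := lagrangian q F (1 * u t + v h t) (1 *: x t + y h t).
pose Lm t := lagrangian q F (-1 * v h t + u t) (-1 *: y h t + x t).
have mp : measurable_fun (`[0, +oo[ : set R) Lp by exact: admissible_measurable admp.
have mm : measurable_fun (`[0, +oo[ : set R) Lm by exact: admissible_measurable admm.
have mu := admissible_measurable cF adm.
have L0 := lagrangian_ge0 _ _ q0 F0.
rewrite -lee_fin EFinD !fineK//.
apply: (le_trans (leeD (value_le_cost F admp) (value_le_cost F admm))).
set cp := cost _ _ _ _; set cm := cost _ _ _ _.
have -> : (cp + cm = \int[@lebesgue_measure R]_(t in `[0%R, +oo[) (Lp t + Lm t)%:E)%E.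
  rewrite -ge0_integralD//.
  - by move=> t _; rewrite lee_fin; exact: L0.
  - exact/measurable_EFinP.
  - by move=> t _; rewrite lee_fin; exact: L0.
  - exact/measurable_EFinP.
(* The constant part of the error must be confined to [0, 1] to have a finite integral; the part
   proportional to the Lagrangian is nonnegative and may extend over the half-line. *)
have := @integral_half_line_le _ (fun t => Lp t + Lm t)
  (fun t => lagrangian q F (u t) (x t)) (cst eta \_ `[0, 1]) (2 + eta * q).
rewrite integral_unit_patch integral_unit_cst => H.
have a0 : 0 <= 2 + eta * q by rewrite addr_ge0// mulr_ge0// ltW.
apply: (le_trans (H _ _ _ _ _ _ _ _)) => {H} //.
- exact: measurable_funD.
- exact: measurable_unit_patch.
- by move=> t _; rewrite addr_ge0//; exact: L0.
- by move=> t _; rewrite unit_patchE; case: ifP.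
- move=> t t0; rewrite unit_patchE t0 /Lp /Lm mul1r scale1r mulN1r scaleN1r.
  rewrite ![- _ + _]addrC /=; have [t1|/ltW t1] := leP t 1; last first.
    have [-> ->] := vy0 h t t1; rewrite !subr0 !addr0.
    by have := mulr_ge0 (mulr_ge0 eta0 (ltW q0)) (L0 (u t) (x t)); lra.
  have [vk yk] := vyK h t t0.
  have hp := Hd _ (u t) _ _ _ (xB t t0 t1) kd vk yk.
  have vk' : `|- v h t| <= K * `|h| by rewrite normrN.
  have yk' : `|- y h t| <= K * `|h| by rewrite normrN.
  have hm := Hd _ (u t) _ _ _ (xB t t0 t1) kd vk' yk'.
  rewrite linearN /= mulrN in hm.
  have -> : eta = 2 * (2 * e' * (K * `|h|)) by rewrite /eta; ring.
  move: hp hm; set X := 2 * e' * _; rewrite /cst; lra.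
have := lee_wpmul2l (_ : (0 <= (2 + eta * q)%:E)%E) costr.
rewrite lee_fin => /(_ a0) h1.
by rewrite [leRHS]EFinD leeD2r// (le_trans h1)// -EFinM.
Qed.

Lemma value_gradient (R : realType) (n : nat) (q : R)
    (F : 'cV[R]_n.+1 -> R) : 1 < q -> continuously_differentiable F ->
  convexR F -> (forall y, 0 <= F y) ->
  (forall x0, value q F x0 \is a fin_num) -> let V := fine \o value q F in
  convexR V -> forall x0 u x p, differentiable V x0 ->
  optimal q F x0 u x -> extremal_lift q F x p -> grad V x0 = - p 0.
Proof.
move=> q1 C1F cvF F0 vf V cvV x0 u x p dV [adm costE] [dx [acp dp]].
have q0 : 0 < q by lra.
have q10 : 0 < (q - 1)^-1 by rewrite invr_gt0; lra.
have cF : continuous F by move=> z; apply: differentiable_continuous; exact: C1F.1.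
have V0 : 0 <= V x0 by apply: fine_ge0; exact: value_ge0.
(* Both sides are linear in [h], so the inequality at [- h] gives the converse. *)
suff main h : dotp (grad V x0) h <= - dotp (p 0) h.
  apply/colP => i; rewrite [RHS]mxE.
  have dE (c : 'cV[R]_n.+1) : dotp c (delta_mx i 0) = c i 0.
    rewrite /dotp (bigD1 i)//= mxE !eqxx mulr1 big1 ?addr0// => j /negbTE ji.
    by rewrite mxE ji mulr0.
  have := main (delta_mx i 0); have := main (- delta_mx i 0).
  by rewrite !linearN /= !dE => ? ?; apply/eqP; rewrite eq_le; apply/andP; split; lra.
have [K [v [y [K0 tr vyK vy0]]]] := steering R n.
have Lv : Lq_control q (v h).
  apply: (Lq_control_bounded q1 (tr h).2 (K := K * `|h|)) => t t0.
    by have [] := vyK h t t0.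
  by have [] := vy0 h t t0.
have admv : admissible q h (v h) (y h) by split; [exact: Lv|exact: (tr h).1].
have costc : (cost q F u x <= (V x0)%:E)%E by rewrite costE /V /= fineK.
have [iu ub] := cost_control_bound q1 cF F0 adm costc.
pose B := n.+1%:R * `|x0| + (1 + q * V x0).
have xB t : 0 <= t -> t <= 1 -> `|x t| <= B.
  move=> t0 t1; rewrite (le_trans (trajectory_bound adm.2 iu t0 t1))//.
  by rewrite lerD2l.
(* Unlike [u], which agrees with it only almost everywhere, [w] satisfies the relation [wE] at every
   time. *)
pose w t := sgn_powR (p t ord_max 0) (q - 1)^-1.
have wE t : sgn_powR (w t) (q - 1) = p t ord_max 0.
  by rewrite sgn_powRK// subr_gt0.
have uw := optimal_control_costate adm.2 dx.
have cx := trajectory_continuous adm.2.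
have mw : measurable_fun (`[0, +oo[ : set R) w.
  have cp : {within `[0, +oo[, continuous p} by exact: ac_continuous_half.
  apply: subspace_continuous_measurable_fun => //.
  apply: (@within_continuous_comp _ _ _ _ p
    (fun z : 'cV[R]_n.+1 => sgn_powR (z ord_max 0) (q - 1)^-1)) => // z _.
  have := @continuous_comp 'cV[R]_n.+1 R R (fun z => z ord_max 0)
    (fun a => sgn_powR a (q - 1)^-1) z.
  by apply; [exact: coord_continuous|exact: sgn_powR_continuous].
have mu := Lq_control_measurable adm.1.
have L0 := lagrangian_ge0 _ _ q0 F0.
have mLw : measurable_fun (`[0, +oo[ : set R) (fun t => lagrangian q F (w t) (x t)).
  exact: measurable_lagrangian.
have costw : cost q F w x = (V x0)%:E.
  by rewrite -(cost_ae q cF mu mw cx uw) costE /V /= fineK.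
pose G t := p t ord_max 0 * v h t + dotp (grad F (x t)) (y h t).
have sub : `[0, 1] `<=` (`[0, +oo[ : set R).
  by move=> t /=; rewrite !in_itv/= andbT => /andP[].
have cg : {within `[0, 1], continuous (grad F \o x)}.
  apply: within_continuous_comp; first by move=> z _; exact: C1F.2.
  exact: continuous_subspaceW cx.
have [Mg Mg0 gM] := within_unit_bounded cg.
have [Mp Mp0 pM] := within_unit_bounded (ac_continuous (acp 1 ltr01)).
have mG : measurable_fun (`[0, 1] : set R) G.
  apply: measurable_funD.
    apply: measurable_funM; last by apply: measurable_funTS; exact: (tr h).2.
    by apply: measurable_coord => //; exact: ac_continuous (acp 1 ltr01).
  apply: measurable_sum => i; apply: measurable_funM.
    exact: (measurable_coord (x := grad F \o x)).
  apply: measurable_coord => //; apply: ac_continuous.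
  by have [_ [+ _]] := (tr h).1; apply.
pose MG := Mp * (K * `|h|) + n.+1%:R * Mg * (K * `|h|).
have GM t : 0 <= t -> t <= 1 -> `|G t| <= MG.
  move=> t0 t1; have [vk yk] := vyK h t t0.
  rewrite (le_trans (ler_normD _ _))// lerD//.
    by rewrite normrM ler_pM// (le_trans (cV_coord_le _ _))// pM.
  rewrite (le_trans (dotp_le _ _))// ler_pM ?mulr_ge0//.
  by rewrite ler_wpM2l//; exact: gM.
have iG : (@lebesgue_measure R).-integrable `[0, 1] (EFin \o G).
  apply: (@le_integrable _ _ _ _ _ _ _ (EFin \o cst MG)) => //.
  - exact/measurable_EFinP.
  - move=> t; rewrite /= in_itv/= => /andP[t0 t1]; rewrite lee_fin.
    by rewrite (le_trans (GM t t0 t1))// ler_norm.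
  apply: continuous_compact_integrable; first exact: segment_compact.
  exact: cst_continuous.
have IG := costate_duality acp dp (tr h).1 (vy0 h 1 (lexx _)).2 iG.
apply/ler_addgt0Pr => e e0.
(* With [e / N] the total error [eta * (1 + q * V x0)] is at most [s * e]; the [+ 1] keeps [N]
   positive when [h = 0]. *)
pose N := 2 * (K * `|h|) * (1 + q * V x0) + 1.
have N0 : 0 < N.
  by rewrite ltr_wpDl// !mulr_ge0 ?addr_ge0 ?mulr_ge0// ltW.
have e'0 : 0 < e / N by rewrite divr_gt0.
have [d d0 Hd] := lagrangian_upper_ball q1 C1F cvF F0 B e'0.
have Kh0 : 0 <= K * `|h| by rewrite mulr_ge0// ltW.
pose s := d / (K * `|h| + 1).
have s0 : 0 < s by rewrite divr_gt0// ltr_wpDl.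
have sd : s * (K * `|h|) <= d.
  by rewrite /s mulrAC ler_pdivrMr ?ltr_wpDl// ler_pM2l// lerDl.
pose eta := 2 * (e / N) * (s * (K * `|h|)).
have eta0 : 0 <= eta by apply: mulr_ge0; apply: mulr_ge0 => //; exact: ltW.
(* As [V] is convex and differentiable, its tangent bounds the left side from below, so a single
   step [s] for each [e] suffices: divide by [s]. *)
suff up : V (x0 + s *: h) <= (1 + eta * q) * V x0 + (s * - dotp (p 0) h + eta).
  have := convex_tangent (s *: h) cvV dV; rewrite derive_dotp// linearZ /=.
  rewrite -[_ *: _]/(s * dotp (grad V x0) h) => tg.
  have : s * dotp (grad V x0) h <= s * (- dotp (p 0) h + e).
    have etaE : eta * (1 + q * V x0) <= s * e.
      have -> : eta * (1 + q * V x0) =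
          s * (e / N * (2 * (K * `|h|) * (1 + q * V x0))) by rewrite /eta; ring.
      rewrite ler_pM2l// mulrAC ler_pdivrMr// ler_pM2l// /N lerDl//.
    lra.
  by rewrite ler_pM2l.
have adms := admissible_lin s q1 admv adm.
rewrite addrC -lee_fin fineK//; apply: (le_trans (value_le_cost F adms)).
have cxs := trajectory_continuous adms.2.
have mvD : measurable_fun (`[0, +oo[ : set R) (v h).
  by apply: measurable_funTS; exact: (tr h).2.
have mws : measurable_fun (`[0, +oo[ : set R) (fun t => s * v h t + w t).
  by apply: measurable_funD => //; exact: measurable_funM.
have -> : cost q F (fun t => s * v h t + u t) (fun t => s *: y h t + x t) =
    cost q F (fun t => s * v h t + w t) (fun t => s *: y h t + x t).
  apply: cost_ae => //; first exact: Lq_control_measurable adms.1.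
  by apply: ae_imp uw => t uw /uw ->.
pose Ls t := lagrangian q F (s * v h t + w t) (s *: y h t + x t).
have mLs : measurable_fun (`[0, +oo[ : set R) Ls by exact: measurable_lagrangian.
(* Adding the constant [M] on [0, 1] makes every integrand nonnegative. *)
pose M := s * MG.
have M0 : 0 <= M.
  by rewrite mulr_ge0 ?(ltW s0)//; exact: le_trans (GM 0 (lexx _) ler01).
have costM : ((cost q F (fun t => (s * v h t + w t)%R)
      (fun t => (s *: y h t + x t)%R) + M%:E)%E =
    \int[@lebesgue_measure R]_(t in `[0%R, +oo[)
      (Ls t + (cst M \_ `[0, 1]) t)%R%:E)%E.
  rewrite -[in LHS](integral_unit_cst M) -integral_unit_patch.
  rewrite -ge0_integralD//.
  - by move=> t _; rewrite lee_fin; exact: L0.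
  - exact/measurable_EFinP.
  - by move=> t _; rewrite lee_fin unit_patchE; case: ifP.
  - by apply/measurable_EFinP; exact: measurable_unit_patch.
pose H t := s * G t + (M + eta).
have ics (c : R) : (@lebesgue_measure R).-integrable `[0, 1] (EFin \o cst c).
  apply: continuous_compact_integrable; first exact: segment_compact.
  exact: cst_continuous.
have isG : (@lebesgue_measure R).-integrable `[0, 1] (EFin \o (fun t => s * G t)).
  have := @integrableZl _ _ _ (@lebesgue_measure R) _ (measurable_itv `[0, 1]) s _ iG.
  by apply: eq_integrable => // t _; rewrite /= EFinM.
have iH : (@lebesgue_measure R).-integrable `[0, 1] (EFin \o H).
  have := @integrableD _ _ _ (@lebesgue_measure R) _ (measurable_itv `[0, 1])
    _ _ isG (ics (M + eta)).
  by apply: eq_integrable => // t _; rewrite /= EFinD.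
have intH : (\int[@lebesgue_measure R]_(t in `[0%R, 1%R]) (H t)%:E =
    (s * - dotp (p 0) h + (M + eta))%:E)%E.
  rewrite -[LHS]fineK; last exact: integrable_fin_num iH.
  congr (_%:E); rewrite -[LHS]/(Rintegral (@lebesgue_measure R) `[0, 1] H).
  rewrite (@RintegralD _ _ _ (@lebesgue_measure R) _ _ _
    (measurable_itv `[0, 1]) isG (ics (M + eta))).
  rewrite (RintegralZl _ _ iG)// IG; congr (_ + _).
  by rewrite /Rintegral integral_unit_cst.
have mH : measurable_fun (`[0, 1] : set R) H.
  by apply/measurable_EFinP; exact: measurable_int iH.
rewrite -(leeD2rE (x := M%:E))// costM.
have cmp := @integral_half_line_le _ (fun t => Ls t + (cst M \_ `[0, 1]) t)
  (fun t => lagrangian q F (w t) (x t)) (H \_ `[0, 1]) (1 + eta * q).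
have a0 : 0 <= 1 + eta * q by rewrite addr_ge0// mulr_ge0// ltW.
have H0 t : 0 <= t -> t <= 1 -> 0 <= H t.
  move=> t0 t1; have := GM t t0 t1; rewrite ler_norml => /andP[+ _].
  by move=> /(ler_wpM2l (ltW s0)); rewrite mulrN -/M /H; lra.
apply: (le_trans (cmp _ _ _ _ _ _ _ _)) => {cmp} //.
- by apply: measurable_funD => //; exact: measurable_unit_patch.
- exact: measurable_unit_patch.
- move=> t _; rewrite addr_ge0//; first exact: L0.
  by rewrite unit_patchE; case: ifP.
- by move=> t _; rewrite unit_patchE; case: ifP => // /andP[? ?]; exact: H0.
- move=> t t0; rewrite !unit_patchE t0 /Ls /=; have [t1|/ltW t1] := leP t 1; last first.
    have [-> ->] := vy0 h t t1; rewrite mulr0 scaler0 !add0r !addr0.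
    by have := mulr_ge0 (mulr_ge0 eta0 (ltW q0)) (L0 (w t) (x t)); lra.
  have [vk yk] := vyK h t t0.
  have vk' : `|s * v h t| <= s * (K * `|h|) by rewrite normrM gtr0_norm// ler_pM2l.
  have yk' : `|s *: y h t| <= s * (K * `|h|) by rewrite normrZ gtr0_norm// ler_pM2l.
  have := Hd _ (w t) _ _ _ (xB t t0 t1) sd vk' yk'.
  rewrite wE linearZ /= -[_ *: dotp _ _]/(s * dotp (grad F (x t)) (y h t)).
  rewrite (addrC (s * _)) (addrC (s *: _)) -/eta /H /G; lra.
rewrite integral_unit_patch intH -[X in (_ * X + _)%E]/(cost q F w x) costw.
by rewrite -EFinM -!EFinD lee_fin; lra.
Qed.

Theorem proposition4p1 (R : realType) (n : nat) (q : R)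
    (F : 'cV[R]_n.+1 -> R)
    (q_gt1 : 1 < q)
    (F_C1 : continuously_differentiable F)
    (F_convex : convex_function [set: convex_lmodType 'cV[R]_n.+1] F)
    (F_0 : F 0 = 0)
    (F_pos : forall x, x != 0 -> 0 < F x) :
  (forall x0 : 'cV[R]_n.+1, value q F x0 \is a fin_num) /\
  continuously_differentiable (fine \o value q F) /\
  (forall (x0 : 'cV[R]_n.+1) (u : R -> R) (x p : R -> 'cV[R]_n.+1),
    optimal q F x0 u x -> extremal_lift q F x p ->
    grad (fine \o value q F) x0 = - p 0).
Proof.
have F0 z : 0 <= F z by have [->|/F_pos/ltW] := eqVneq z 0; rewrite ?F_0.
have q0 : 0 < q by lra.
have cvF := convex_functionP F_convex.
have cF : continuous F by move=> z; apply: differentiable_continuous; exact: F_C1.1.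
(* Steering [x0] itself to the origin has finite cost, as [F 0 = 0] makes the integrand vanish after
   time 1. *)
have vf x0 : value q F x0 \is a fin_num.
  have [K [v [y [_ tr vyK vy0]]]] := steering R n.
  have vK t : 0 <= t -> `|v x0 t| <= K * `|x0| by move=> /(vyK x0)[].
  have adm : admissible q x0 (v x0) (y x0).
    split; last exact: (tr x0).1.
    by apply: (Lq_control_bounded q_gt1 (tr x0).2 vK) => t /(vy0 x0)[].
  rewrite ge0_fin_numE; last exact: value_ge0.
  apply: (le_lt_trans (value_le_cost F adm)).
  exact: steering_finite_cost adm vK (vy0 x0).
have cvV := value_convex q_gt1 cF F0 cvF vf.
have dV x0 : differentiable (fine \o value q F) x0.
  apply: convex_differentiable => //.
  exact: value_second_difference.
split=> //; split; first by split=> //; exact: convex_grad_continuous.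
by move=> x0 u x p; apply: value_gradient.
Qed.
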